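(* Let $f:\mathbb{R}^d\to\mathbb{R}$ be differentiable, with $L$-Lipschitz gradient for some $L>0$ and $\mu$-strongly convex for some $\mu>0$, with unique minimizer $\mathbf{x}^\star$. Let $\boldsymbol{\Psi}(\mathbf{x})=[\mathcal{N}_1(x_1),\ldots,\mathcal{N}_1(x_d)]^\top$ be an admissible component-wise nonlinearity (as defined in the context), and let the noise sequence $\{\mathbf{z}^{(t)}\}_{t\in\mathbb{N}_0}$ satisfy the noise assumption in the context. Let $\mathbf{x}^{(0)}\in\mathbb{R}^d$ be deterministic and let $$\mathbf{x}^{(t+1)}=\mathbf{x}^{(t)}-\alpha_t\boldsymbol{\Psi}\big(\nabla f(\mathbf{x}^{(t)})+\mathbf{z}^{(t)}\big),\qquad \alpha_t=\frac{a}{(t+2)^\delta},$$ for any $\delta\in(3/4,1)$ and $a>0$. For $t\ge1$ let $\widehat{\mathbf{x}}^{(t)}=\sum_{k=0}^{t-1}\widetilde{\alpha}_k\mathbf{x}^{(k)}$ with $\widetilde{\alpha}_k=\alpha_k/\sum_{j=0}^{t-1}\alpha_j$. Then, for any integer $t\ge1$ and any $\beta\in(0,1)$, with probability at least $1-\beta$, $$H_{\xi\sqrt d/\mu}\big(\|\widehat{\mathbf{x}}^{(t)}-\mathbf{x}^\star\|\big)\le\frac{\widetilde R(a,\beta,\delta)}{(t+2)^{1-\delta}-2^{1-\delta}},$$ where $$\widetilde R(a,\beta,\delta)=\frac{2d(1-\delta)}{\mu^2\phi'(0)}\left[\frac{f(\mathbf{x}^{(0)})-f^\star+\log(1/\b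eta)}{a}+\frac{a\left(dLC_1^2/2+2NL^2D_{\mathcal{X}}(\mathbf{x}^{(0)})\right)}{2\delta-1}+\frac{2a^3dNC_1^2L^2}{(1-\delta)^2(4\delta-3)}\right].$$
   Context: Norms and inner products are Euclidean; $[d]=\{1,\dots,d\}$. $\mu$-strong convexity: $f(\mathbf{y})\ge f(\mathbf{x})+\langle\nabla f(\mathbf{x}),\mathbf{y}-\mathbf{x}\rangle+\frac{\mu}{2}\|\mathbf{x}-\mathbf{y}\|^2$ for all $\mathbf{x},\mathbf{y}$. Huber loss with parameter $\lambda>0$: $H_\lambda(x)=\frac12x^2$ if $|x|\le\lambda$, and $H_\lambda(x)=\lambda|x|-\frac{\lambda^2}{2}$ if $|x|>\lambda$. Admissible component-wise nonlinearity: $\boldsymbol{\Psi}(\mathbf{x})=[\mathcal{N}_1(x_1),\ldots,\mathcal{N}_1(x_d)]^\top$, where $\mathcal{N}_1:\mathbb{R}\to\mathbb{R}$ is continuous almost everywhere (Lebesgue) and piecewise differentiable; monotonically non-decreasing and odd; either discontinuous at zero or strictly increasing on $(-c_1,c_1)$ for some $c_1>0$; and uniformly bounded, $|\mathcal{N}_1(x)|\le C_1$ for all $x\in\mathbb{R}$, for some $C_1>0$. Noise assumption: the vectors $\{\mathbf{z}^{(t)}\}_{t\in\mathbb{N}_0}$ in $\mathbb{R}^d$ are independent, identically distributed, integrable and zero mean, with a symmetric probability density $p:\mathbb{R}^d\to[0,\infty)$ ($p(-\mathbf{z})=p(\mathbf{z})$) such that $p(\mathbf{z})>0$ for all $\|\mathbf{z}\|\le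 B_0$, for some $B_0>0$. Notation. $f^\star=\inf_{\mathbf{x}}f(\mathbf{x})=f(\mathbf{x}^\star)$; $\mathcal{X}=\{\mathbf{x}:\nabla f(\mathbf{x})=0\}=\{\mathbf{x}^\star\}$; $D_{\mathcal{X}}(\mathbf{x}^{(0)})=\inf_{\mathbf{x}\in\mathcal{X}}\|\mathbf{x}^{(0)}-\mathbf{x}\|^2$. $\boldsymbol{\Phi}(\mathbf{x})=\mathbb{E}_{\mathbf{z}}[\boldsymbol{\Psi}(\mathbf{x}+\mathbf{z})]=\int\boldsymbol{\Psi}(\mathbf{x}+\mathbf{z})p(\mathbf{z})\,d\mathbf{z}$, whose $i$-th component is $\phi_i(x_i)=\mathbb{E}[\mathcal{N}_1(x_i+z_i)]$, $z_i$ being the $i$-th component of $\mathbf{z}\sim p$. It is taken as given from prior work (Polyak–Tsypkin) that each $\phi_i$ is non-decreasing and odd, and differentiable at zero with $\phi_i'(0)>0$; set $\phi'(0)=\min_{i\in[d]}\phi_i'(0)$. $\xi>0$ is a constant, depending only on the nonlinearity and the noise, such that $\langle\boldsymbol{\Phi}(\mathbf{x}),\mathbf{x}\rangle\ge\frac{\phi'(0)}{2}\min\{\xi\|\mathbf{x}\|/\sqrt d,\|\mathbf{x}\|^2/d\}$ for all $\mathbf{x}\in\mathbb{R}^d$ (such a constant exists). $N>0$ is a constant, depending only on the nonlinearity, such that the effective noise $\mathbf{e}^{(t)}=\boldsymbol{\Phi}(\nabla f(\mathbf{x}^{(t)}))-\boldsymbol{\Psi}(\nabla f(\mathbf{x}^{(t)})+\mathbf{z}^{(t)})$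 satisfies $\mathbb{E}[\exp(\langle\mathbf{x},\mathbf{e}^{(t)}\rangle)\mid\mathcal{F}_t]\le\exp(N\|\mathbf{x}\|^2)$ for all $\mathcal{F}_t$-measurable (in particular all deterministic) $\mathbf{x}\in\mathbb{R}^d$ and all $t$, where $\mathcal{F}_t=\sigma(\mathbf{z}^{(0)},\ldots,\mathbf{z}^{(t-1)})$, $\mathcal{F}_0$ trivial (such a constant exists). *)

(* Defs.v *)
(* MathComp / MathComp-Analysis; the reals are an arbitrary [R : realType]. *)
From HB Require Import structures.
From mathcomp Require Import all_boot all_order all_algebra.
From mathcomp Require Import all_classical all_reals all_analysis measurable_realfun.

Set Implicit Arguments.
Unset Strict Implicit.
Unset Printing Implicit Defensive.

Import Order.TTheory GRing.Theory Num.Theory.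
Import numFieldNormedType.Exports.

Local Open Scope classical_set_scope.
Local Open Scope ring_scope.

(* The library's norm [`|x|] on ['rV[R]_d] is the sup norm, hence these. *)
Definition dotv (R : realType) (d : nat) (x y : 'rV[R]_d) : R :=
  \sum_(i < d) x 0 i * y 0 i.

Definition enorm (R : realType) (d : nat) (x : 'rV[R]_d) : R :=
  Num.sqrt (dotv x x).

(* ['rV[R]_d] carries the sigma-algebra generated by the coordinates, i.e. the
   Borel one; this mirrors the library's instance on [d.-tuple R]. *)
Definition rV_display : measure_display.
Proof. exact: (measure_tuple_display default_measure_display). Qed.

Section measurable_rV.
Variables (R : realType) (d : nat).

Let coord : 'I_d -> 'rV[R]_d -> R := fun i x => x 0 i.

Let rV_set0 : g_sigma_preimage coord set0.
Proof. exact: sigma_algebra0. Qed.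

Let rV_setC A : g_sigma_preimage coord A -> g_sigma_preimage coord (~` A).
Proof. exact: sigma_algebraC. Qed.

Let rV_bigcup (F : _^nat) : (forall i, g_sigma_preimage coord (F i)) ->
  g_sigma_preimage coord (\bigcup_i (F i)).
Proof. exact: sigma_algebra_bigcup. Qed.

HB.instance Definition _ := @isMeasurable.Build rV_display
  'rV[R]_d (g_sigma_preimage coord) rV_set0 rV_setC rV_bigcup.

End measurable_rV.

Lemma measurable_rV_coord (R : realType) (d : nat) (i : 'I_d) :
  measurable_fun setT (fun x : 'rV[R]_d => x 0 i).
Proof.
move=> _ Y mY; rewrite setTI; apply: sub_sigma_algebra => /=.
rewrite -bigcup_seq/=; exists i => /=; first by rewrite mem_index_enum.
by exists Y => //; rewrite setTI.
Qed.

Lemma measurable_fun_rV (R : realType) (d : nat) (dT : measure_display)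
    (T : measurableType dT) (f : T -> 'rV[R]_d) :
  (forall i, measurable_fun setT (fun t => f t 0 i)) -> measurable_fun setT f.
Proof.
move=> mf _ A; rewrite setTI => mA.
suff : measurable `<=` [set B | measurable (f @^-1` B)] by exact.
apply: smallest_sub => /= [|B].
  split => [|C mC|F mF].
  - by rewrite /= preimage_set0.
  - rewrite setTD; exact: (@measurableC _ _ (f @^-1` C)).
  - by rewrite /= preimage_bigcup; exact: bigcupT_measurable.
rewrite -bigcup_seq => -[i /= _ [C mC <-]].
by rewrite setTI; have := mf i measurableT C mC; rewrite setTI.
Qed.

Definition consv (R : realType) (n : nat) (u : R * 'rV[R]_n) : 'rV[R]_n.+1 :=
  \row_i (if unlift ord0 i is Some j then u.2 0 j else u.1).

Lemma measurable_consv (R : realType) (n : nat) :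
  measurable_fun setT (@consv R n).
Proof.
apply: measurable_fun_rV => i; under eq_fun do rewrite mxE.
case: unliftP => [j _|_] /=; last exact: measurable_fst.
apply: (@measurableT_comp _ _ _ _ _ _ (fun x : 'rV[R]_n => x 0 j)) => //.
exact: measurable_rV_coord.
Qed.

Section lebesgue_cons.
Local Open Scope ereal_scope.
Variables (R : realType) (n : nat).
Variable m : {sigma_finite_measure set 'rV[R]_n -> \bar R}.

Definition lebesgue_cons : set 'rV[R]_n.+1 -> \bar R :=
  pushforward (@lebesgue_measure R \x m) (@consv R n).

Let lebesgue_cons0 : lebesgue_cons set0 = 0.
Proof.
apply: (@measure0 _ _ _ (pushforward (@lebesgue_measure R \x m) _)).
exact: measurable_consv.
Qed.

Let lebesgue_cons_ge0 A : 0 <= lebesgue_cons A.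
Proof.
apply: (@measure_ge0 _ _ _ (pushforward (@lebesgue_measure R \x m) _)).
exact: measurable_consv.
Qed.

Let lebesgue_cons_sigma_additive : semi_sigma_additive lebesgue_cons.
Proof.
apply: (@measure_semi_sigma_additive _ _ _ (pushforward (@lebesgue_measure R \x m) _)).
exact: measurable_consv.
Qed.

HB.instance Definition _ := isMeasure.Build _ _ _ lebesgue_cons
  lebesgue_cons0 lebesgue_cons_ge0 lebesgue_cons_sigma_additive.

Let lebesgue_cons_sigma_finite : sigma_finite setT lebesgue_cons.
Proof.
have /sigma_finiteP[F [TF ndF Foo]] := sigma_finiteT (@lebesgue_measure R).
have /sigma_finiteP[G [TG ndG Goo]] := sigma_finiteT m.
pose tl (v : 'rV[R]_n.+1) := (v 0 ord0, \row_j v 0 (lift ord0 j))%R.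
have mtl : measurable_fun setT tl.
  apply/measurable_fun_pairP; split; first exact: measurable_rV_coord.
  apply: measurable_fun_rV => j; under eq_fun do rewrite /= mxE.
  exact: measurable_rV_coord.
have consvK u : tl (consv u) = u.
  case: u => a v; rewrite /tl mxE unlift_none/=; congr pair.
  by apply/rowP => j; rewrite !mxE liftK.
exists (fun k => tl @^-1` (F k `*` G k)).
  rewrite -preimage_bigcup (_ : \bigcup_k _ = setT) ?preimage_setT//.
  rewrite -setXTT TF TG predeqE => -[x y]; split.
    by move=> [k _ []/= ? ?]; split; exists k.
  move=> [/= [k _ Fkx] [l _ Gly]]; exists (maxn k l) => //; split.
  - by move: x Fkx; exact/subsetPset/ndF/leq_maxl.
  - by move: y Gly; exact/subsetPset/ndG/leq_maxr.
move=> k; have [mF Fk] := Foo k; have [mG Gk] := Goo k.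
have mFG : measurable (F k `*` G k) by exact: measurableX.
split; first by rewrite -[X in measurable X]setTI; exact: mtl.
rewrite /lebesgue_cons /pushforward -comp_preimage.
rewrite (_ : tl \o _ = id) ?preimage_id; last by apply/funext => u; exact: consvK.
by rewrite product_measure1E// lte_mul_pinfty// ge0_fin_numE.
Qed.

HB.instance Definition _ := Measure_isSigmaFinite.Build _ _ _ lebesgue_cons
  lebesgue_cons_sigma_finite.

End lebesgue_cons.

Fixpoint lebesgue_rV (R : realType) (d : nat) :
    {sigma_finite_measure set 'rV[R]_d -> \bar R} :=
  match d with
  | 0 => \d_(0 : 'rV[R]_0)
  | n.+1 => lebesgue_cons (lebesgue_rV R n)
  end.

Lemma lebesgue_rV_box (R : realType) (d : nat) (A : 'I_d -> set R) :
  (forall i, measurable (A i)) ->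
  lebesgue_rV R d [set x | forall i, A i (x 0 i)] =
  (\prod_(i < d) lebesgue_measure (A i))%E.
Proof.
elim: d A => [|d ih] A mA.
  rewrite big_ord0 /= diracE mem_set//=.
  by case.
pose B := [set x : 'rV[R]_d | forall i, A (lift ord0 i) (x 0 i)].
have mB : measurable B.
  rewrite (_ : B = \big[setI/setT]_(i < d)
      ((fun x : 'rV[R]_d => x 0 i) @^-1` A (lift ord0 i))).
    apply: bigsetI_measurable => i _.
    by rewrite -[X in measurable X]setTI; exact: measurable_rV_coord.
  apply/seteqP; split => x /=; rewrite -bigcap_seq /=.
    by move=> Bx i _; exact: Bx.
  by move=> Bx i; apply: Bx => /=; rewrite mem_index_enum.
rewrite big_ord_recl -ih// -product_measure1E//=; last exact: mA.
rewrite /lebesgue_cons /pushforward; congr (_ _).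
apply/seteqP; split => -[b v] /=.
- move=> H; split => [|i]; first by have := H ord0; rewrite mxE unlift_none.
  by have := H (lift ord0 i); rewrite mxE liftK.
- by move=> [Aa Av] i; rewrite mxE; case: unliftP => [j ->|->].
Qed.

Definition gradient (R : realType) (d : nat) (f : 'rV[R]_d -> R)
    (x : 'rV[R]_d) : 'rV[R]_d :=
  \row_(i < d) 'D_(delta_mx 0 i) f x.

Definition lipschitz_gradient (R : realType) (d : nat) (L : R)
    (f : 'rV[R]_d -> R) : Prop :=
  forall x y, enorm (gradient f x - gradient f y) <= L * enorm (x - y).

Definition strongly_convex (R : realType) (d : nat) (mu : R)
    (f : 'rV[R]_d -> R) : Prop :=
  forall x y,
    f x + dotv (gradient f x) (y - x) + mu / 2 * enorm (x - y) ^+ 2 <= f y.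

Definition unique_minimizer (R : realType) (d : nat) (f : 'rV[R]_d -> R)
    (xs : 'rV[R]_d) : Prop :=
  (forall x, f xs <= f x) /\
  (forall y, (forall x, f y <= f x) -> y = xs).

Definition dist_stationary (R : realType) (d : nat) (f : 'rV[R]_d -> R)
    (x0 : 'rV[R]_d) : R :=
  inf [set enorm (x0 - x) ^+ 2 | x in [set x | gradient f x = 0]].

Definition huber (R : realType) (lambda x : R) : R :=
  if `|x| <= lambda then x ^+ 2 / 2 else lambda * `|x| - lambda ^+ 2 / 2.

(* [S] is the set of breakpoints: finitely many in each bounded interval. *)
Definition piecewise_differentiable (R : realType) (g : R -> R) : Prop :=
  exists S : set R,
    (forall r : R, finite_set (S `&` `[- r, r])) /\
    (forall x, ~ S x -> derivable g x 1).

Record admissible (R : realType) (C1 : R) (N1 : R -> R) : Prop := Admissible {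
  admissible_ae_continuous :
    {ae (@lebesgue_measure R), forall x, {for x, continuous N1}};
  admissible_piecewise : piecewise_differentiable N1;
  admissible_nondecreasing : {homo N1 : x y / x <= y};
  admissible_odd : forall x, N1 (- x) = - N1 x;
  admissible_zero :
    ~ {for 0, continuous N1} \/
    exists2 c1 : R, 0 < c1 &
      {in `]- c1, c1[ &, {homo N1 : x y / x < y}};
  admissible_C1_gt0 : 0 < C1;
  admissible_bounded : forall x, `|N1 x| <= C1
}.

Definition Psi (R : realType) (d : nat) (N1 : R -> R) (x : 'rV[R]_d) :
    'rV[R]_d :=
  \row_(i < d) N1 (x 0 i).

Definition mutually_independent (R : realType) (dO : measure_display)
    (Omega : measurableType dO) (P : probability Omega R)
    (dT : measure_display) (T : measurableType dT)
    (z : nat -> {mfun Omega >-> T}) : Prop :=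
  forall (J : seq nat) (A : nat -> set T),
    uniq J -> (forall t, measurable (A t)) ->
    P (\bigcap_(t in [set` J]) z t @^-1` A t) =
    (\prod_(t <- J) P (z t @^-1` A t))%E.

(* Integrability and expectation of the vectors are taken coordinatewise. *)
Record noise_assumption (R : realType) (dO : measure_display)
    (Omega : measurableType dO) (P : probability Omega R) (d : nat)
    (p : 'rV[R]_d -> R) (z : nat -> {mfun Omega >-> 'rV[R]_d}) : Prop :=
  NoiseAssumption {
  noise_independent : mutually_independent P z;
  noise_identically_distributed : forall s t (A : set 'rV[R]_d),
    measurable A -> distribution P (z s) A = distribution P (z t) A;
  noise_integrable : forall t (i : 'I_d),
    P.-integrable setT (fun w => (z t w 0 i)%:E);
  noise_zero_mean : forall t (i : 'I_d), ('E_P[fun w => (z t w 0 i)%R] = 0)%E;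
  noise_density_measurable : measurable_fun setT p;
  noise_density_ge0 : forall u, 0 <= p u;
  noise_density : forall t (A : set 'rV[R]_d), measurable A ->
    distribution P (z t) A = (\int[lebesgue_rV R d]_(u in A) (p u)%:E)%E;
  noise_density_symmetric : forall u, p (- u) = p u;
  noise_density_gt0 :
    exists2 B0 : R, 0 < B0 & forall u, enorm u <= B0 -> 0 < p u
}.

Definition Phi (R : realType) (d : nat) (N1 : R -> R) (p : 'rV[R]_d -> R)
    (x : 'rV[R]_d) : 'rV[R]_d :=
  \row_(i < d) (\int[lebesgue_rV R d]_u (Psi N1 (x + u) 0 i * p u))%R.

Definition phi (R : realType) (d : nat) (N1 : R -> R) (p : 'rV[R]_d -> R)
    (i : 'I_d) (s : R) : R :=
  (\int[lebesgue_rV R d]_u (N1 (s + u 0 i) * p u))%R.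

(* [hd] only supplies a base value for the minimum over a nonempty range. *)
Definition phi_prime (R : realType) (d : nat) (hd : (0 < d)%N) (N1 : R -> R)
    (p : 'rV[R]_d -> R) : R :=
  \big[Num.min/derive1 (phi N1 p (Ordinal hd)) 0]_(i < d) derive1 (phi N1 p i) 0.

Definition step_size (R : realType) (a delta : R) (t : nat) : R :=
  a / (t.+2%:R `^ delta).

Fixpoint sgd (R : realType) (d : nat) (f : 'rV[R]_d -> R) (N1 : R -> R)
    (alpha : nat -> R) (x0 : 'rV[R]_d) (Omega : Type)
    (z : nat -> Omega -> 'rV[R]_d) (t : nat) (w : Omega) : 'rV[R]_d :=
  if t is s.+1 then
    let x := sgd f N1 alpha x0 z s w in
    x - alpha s *: Psi N1 (gradient f x + z s w)
  else x0.

Definition weighted_average (R : realType) (d : nat) (alpha : nat -> R)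
    (x : nat -> 'rV[R]_d) (t : nat) : 'rV[R]_d :=
  \sum_(k < t) (alpha k / \sum_(j < t) alpha j) *: x k.

Definition effective_noise (R : realType) (d : nat) (f : 'rV[R]_d -> R)
    (N1 : R -> R) (p : 'rV[R]_d -> R) (x z : 'rV[R]_d) : 'rV[R]_d :=
  Phi N1 p (gradient f x) - Psi N1 (gradient f x + z).

(* Trivial for [t = 0], since [<<s set0 >>] is the sigma-algebra {set0, setT}. *)
Definition filtration (dO : measure_display) (Omega : measurableType dO)
    (dT : measure_display) (T : measurableType dT)
    (z : nat -> {mfun Omega >-> T}) (t : nat) : set (set Omega) :=
  <<s \bigcup_(k in [set k | (k < t)%N])
        preimage_set_system setT (z k) measurable >>.

Definition measurable_wrt (Omega : Type) (G : set (set Omega))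
    (dT : measure_display) (T : measurableType dT) (X : Omega -> T) : Prop :=
  forall A : set T, measurable A -> G (X @^-1` A).

(* [E] is a version of the conditional expectation of [Y] given [G]; it is only
   used for [Y >= 0], so no integrability is required. *)
Definition is_cond_expectation (R : realType) (dO : measure_display)
    (Omega : measurableType dO) (P : probability Omega R)
    (G : set (set Omega)) (Y E : Omega -> \bar R) : Prop :=
  measurable_wrt G E /\
  (forall A, G A -> (\int[P]_(w in A) E w = \int[P]_(w in A) Y w)%E).

(* "The conditional expectation is almost surely at most the bound" is said of
   a version [E], versions being almost surely equal. *)
Definition effective_noise_mgf (R : realType) (dO : measure_display)
    (Omega : measurableType dO) (P : probability Omega R) (d : nat)
    (z : nat -> {mfun Omega >-> 'rV[R]_d})
    (e : nat -> Omega -> 'rV[R]_d) (N : R) : Prop :=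
  forall (t : nat) (X : Omega -> 'rV[R]_d),
    measurable_wrt (filtration z t) X ->
    exists2 E : Omega -> \bar R,
      is_cond_expectation P (filtration z t)
        (fun w => (expR (dotv (X w) (e t w)))%:E) E &
      {ae P, forall w, (E w <= (expR (N * enorm (X w) ^+ 2))%:E)%E}.

(* [phi0] stands for phi'(0), [gap] for f(x0) - inf f and [D] for the squared
   distance from x0 to the stationary points. *)
Definition R_tilde (R : realType) (d : nat) (mu L C1 N phi0 gap D : R)
    (a beta delta : R) : R :=
  2 * d%:R * (1 - delta) / (mu ^+ 2 * phi0) *
  ((gap + ln (1 / beta)) / a
   + a * (d%:R * L * C1 ^+ 2 / 2 + 2 * N * L ^+ 2 * D) / (2 * delta - 1)
   + 2 * a ^+ 3 * d%:R * N * C1 ^+ 2 * L ^+ 2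
       / ((1 - delta) ^+ 2 * (4 * delta - 3))).

(* Main.v *)
(* The descent lemma and the decomposition Psi(g + z) = Phi(g) - e of the noisy
   step give, after telescoping,
     sum_k al_k <Phi(g_k), g_k>
       <= f(x_0) - f* + sum_k al_k <g_k, e_k> + (d L C1^2 / 2) sum_k al_k^2.
   The moment bound on e_k makes
     exp (sum_(k < t) (al_k <g_k, e_k> - N al_k^2 |g_k|^2))
   a supermartingale, so with probability at least 1 - beta the noise term is at
   most log (1 / beta) + N sum_k al_k^2 |g_k|^2. As |g_k| <= L |x_k - x*| and the
   iterates drift by at most sqrt(d) C1 sum_(j < k) al_j from x_0, the last sum
   converges when delta > 3/4. On the left, strong convexity turns <Phi(g_k), g_k>
   into a multiple of the Huber loss of |x_k - x*|, and Jensen's inequality passes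
   to the weighted average. *)

Require Import Defs.
From mathcomp Require Import all_boot all_order all_algebra.
From mathcomp Require Import all_classical all_reals all_analysis measurable_realfun.
From mathcomp Require Import ring lra.
Import Order.TTheory GRing.Theory Num.Theory.
Import numFieldNormedType.Exports HBNNSimple.
Local Open Scope classical_set_scope.
Local Open Scope ring_scope.

(** * Euclidean geometry and smooth strongly convex functions *)

Lemma dotvC {R : realType} {d} (x y : 'rV[R]_d) : dotv x y = dotv y x.
Proof. by apply: eq_bigr => i _; rewrite mulrC. Qed.

Lemma dotvDl {R : realType} {d} (x y w : 'rV[R]_d) :
  dotv (x + y) w = dotv x w + dotv y w.
Proof. by rewrite -big_split; apply: eq_bigr => i _; rewrite mxE mulrDl. Qed.

Lemma dotvZl {R : realType} {d} (c : R) (x w : 'rV[R]_d) :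
  dotv (c *: x) w = c * dotv x w.
Proof. by rewrite mulr_sumr; apply: eq_bigr => i _; rewrite mxE mulrA. Qed.

Lemma dotvNl {R : realType} {d} (x w : 'rV[R]_d) : dotv (- x) w = - dotv x w.
Proof. by rewrite -scaleN1r dotvZl mulN1r. Qed.

Lemma dotvDr {R : realType} {d} (w x y : 'rV[R]_d) :
  dotv w (x + y) = dotv w x + dotv w y.
Proof. by rewrite dotvC dotvDl !(dotvC w). Qed.

Lemma dotvZr {R : realType} {d} (c : R) (w x : 'rV[R]_d) :
  dotv w (c *: x) = c * dotv w x.
Proof. by rewrite dotvC dotvZl dotvC. Qed.

Lemma dotvNr {R : realType} {d} (w x : 'rV[R]_d) : dotv w (- x) = - dotv w x.
Proof. by rewrite dotvC dotvNl dotvC. Qed.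

Lemma dotvv_ge0 {R : realType} {d} (x : 'rV[R]_d) : 0 <= dotv x x.
Proof. by apply: sumr_ge0 => i _; rewrite -expr2 sqr_ge0. Qed.

Lemma enorm_ge0 {R : realType} {d} (x : 'rV[R]_d) : 0 <= enorm x.
Proof. exact: sqrtr_ge0. Qed.

Lemma sqr_enorm {R : realType} {d} (x : 'rV[R]_d) : enorm x ^+ 2 = dotv x x.
Proof. by rewrite sqr_sqrtr// dotvv_ge0. Qed.

Lemma enormZ {R : realType} {d} (c : R) (x : 'rV[R]_d) :
  enorm (c *: x) = `|c| * enorm x.
Proof.
by rewrite /enorm dotvZl dotvZr mulrA -expr2 sqrtrM ?sqr_ge0// sqrtr_sqr.
Qed.

Lemma enormN {R : realType} {d} (x : 'rV[R]_d) : enorm (- x) = enorm x.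
Proof. by rewrite -scaleN1r enormZ normrN1 mul1r. Qed.

Lemma enorm0 {R : realType} {d} : enorm (0 : 'rV[R]_d) = 0.
Proof. by rewrite -(scale0r 0) enormZ normr0 mul0r. Qed.

Lemma enorm_eq0 {R : realType} {d} (x : 'rV[R]_d) : enorm x = 0 -> x = 0.
Proof.
move=> x0; have /eqP := sqr_enorm x; rewrite x0 expr0n/= eq_sym.
rewrite psumr_eq0; last by move=> i _; rewrite -expr2 sqr_ge0.
move=> /allP H; apply/rowP => i; rewrite mxE.
by have := H i (mem_index_enum _); rewrite /= mulf_eq0 orbb => /eqP.
Qed.

Lemma cauchy_schwarz {R : realType} {d} (x y : 'rV[R]_d) :
  dotv x y <= enorm x * enorm y.
Proof.
have [y0|yN0] := eqVneq (enorm y) 0.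
  by rewrite y0 (enorm_eq0 _ y0) mulr0 -(scale0r 0) dotvZr mul0r.
have yp : 0 < dotv y y.
  by rewrite -sqr_enorm exprn_gt0// lt_neqAle eq_sym yN0 enorm_ge0.
(* With [A], [B], [C] as set below, this square expands to [B * (A * B - C ^+ 2)]. *)
have := dotvv_ge0 (dotv y y *: x - dotv x y *: y).
rewrite !(dotvDl, dotvDr, dotvNl, dotvNr, dotvZl, dotvZr) (dotvC y x).
set A := dotv x x; set B := dotv y y in yp *; set C := dotv x y => H.
have {}H : 0 <= A * B - C ^+ 2.
  rewrite -(pmulr_rge0 _ yp); apply: le_trans H _.
  by rewrite le_eqVlt; apply/orP; left; apply/eqP; ring.
rewrite /enorm -/A -/B -sqrtrM ?dotvv_ge0//.
by apply: le_trans (ler_norm _) _; rewrite -sqrtr_sqr ler_wsqrtr// -subr_ge0.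
Qed.

Lemma enormD {R : realType} {d} (x y : 'rV[R]_d) :
  enorm (x + y) <= enorm x + enorm y.
Proof.
rewrite -ler_sqr ?nnegrE ?addr_ge0 ?enorm_ge0// sqrrD !sqr_enorm.
rewrite !(dotvDl, dotvDr) (dotvC y x).
have := cauchy_schwarz x y; lra.
Qed.

Lemma enorm_sum {R : realType} {d} (I : Type) (r : seq I) (F : I -> 'rV[R]_d) :
  enorm (\sum_(i <- r) F i) <= \sum_(i <- r) enorm (F i).
Proof.
elim/big_ind2: _ => [||//]; first by rewrite enorm0.
by move=> x1 x2 y1 y2 h1 h2; apply: le_trans (enormD _ _) _; exact: lerD.
Qed.

Lemma sqr_enorm_Psi {R : realType} {d} (N1 : R -> R) (C1 : R) (x : 'rV[R]_d) :
  (forall s, `|N1 s| <= C1) -> enorm (Psi N1 x) ^+ 2 <= d%:R * C1 ^+ 2.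
Proof.
move=> NC; have -> : d%:R * C1 ^+ 2 = \sum_(i < d) C1 ^+ 2 :> R.
  by rewrite sumr_const card_ord mulr_natl.
rewrite sqr_enorm; apply: ler_sum => i _; rewrite mxE -expr2 -real_normK ?num_real//.
by rewrite lerXn2r ?nnegrE// (le_trans _ (NC (x 0 i))).
Qed.

(* No integration along the segment is needed: splitting it into n pieces and
   applying convexity on each of them gives the bound with constant
   L (n + 1) / (2 n); then n tends to infinity. *)
Lemma descent {R : realType} {d} (f : 'rV[R]_d -> R) (L : R) :
  0 <= L -> (forall x y, f x + dotv (gradient f x) (y - x) <= f y) ->
  lipschitz_gradient L f ->
  forall x y, f y <= f x + dotv (gradient f x) (y - x) + L / 2 * enorm (y - x) ^+ 2.
Proof.
move=> L0 fcvx fL x y; set h := y - x.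
have step (n : nat) (k : nat) :
    f (x + (k%:R / n.+1%:R) *: h) <= f x + k%:R / n.+1%:R * dotv (gradient f x) h
      + L * (k%:R * k.+1%:R / 2 / n.+1%:R ^+ 2) * enorm h ^+ 2.
  elim: k => [|k IH]; first by rewrite !(mul0r, mulr0) scale0r !addr0.
  have n0 : n.+1%:R != 0 :> R by rewrite pnatr_eq0.
  have n1 : 0 <= n.+1%:R^-1 :> R by rewrite invr_ge0.
  set u := x + (k%:R / n.+1%:R) *: h in IH *.
  set v := x + (k.+1%:R / n.+1%:R) *: h.
  have uv : u - v = - (n.+1%:R^-1 *: h).
    apply/rowP => i; rewrite !mxE -(natr1 k).
    by move: (n.+1%:R) n0 => m n0; field.
  have vx : v - x = (k.+1%:R / n.+1%:R) *: h by rewrite /v addrC addKr.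
  (* Convexity at the new point [v], looking back to [u], bounds [f v - f u] by the slope at [v].
     That slope exceeds the one at [x] by at most a multiple of [k.+1]; summing these excesses
     produces the factor [k%:R * k.+1%:R / 2]. *)
  have Hv := fcvx v u; rewrite uv dotvNr dotvZr in Hv.
  have : dotv (gradient f v - gradient f x) h <=
      L * (k.+1%:R / n.+1%:R) * enorm h ^+ 2.
    apply: le_trans (cauchy_schwarz _ _) _.
    rewrite expr2 mulrA; apply: ler_wpM2r; first exact: enorm_ge0.
    apply: le_trans (fL _ _) _; rewrite vx enormZ ger0_norm ?divr_ge0//.
    by rewrite mulrA.
  rewrite dotvDl dotvNl => Hg.
  have {}Hg := ler_wpM2l n1 Hg.
  have E : L * (k.+1%:R * k.+2%:R / 2 / n.+1%:R ^+ 2) * enorm h ^+ 2 =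
    L * (k%:R * k.+1%:R / 2 / n.+1%:R ^+ 2) * enorm h ^+ 2 +
    n.+1%:R^-1 * (L * (k.+1%:R / n.+1%:R) * enorm h ^+ 2).
    rewrite -(natr1 k.+1) -(natr1 k).
    by move: (n.+1%:R) n0 => m n0; field.
  rewrite {}E; set E1 := _ * enorm h ^+ 2 in IH *.
  move: IH Hv Hg; rewrite -/u -/v -(natr1 k) mulrDl mul1r.
  set i := n.+1%:R^-1; set q := _ * enorm h ^+ 2.
  move: (f u) (f v) (dotv (gradient f v) h) (dotv (gradient f x) h) => fu fv gv gx.
  rewrite mulrBr => *; rewrite mulrDl; lra.
have {}step n : f y <= f x + dotv (gradient f x) h
      + L / 2 * enorm h ^+ 2 + (L / 2 * enorm h ^+ 2) / n.+1%:R.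
  have := step n n.+1; rewrite divff ?pnatr_eq0// scale1r mul1r addrC subrK => H.
  apply: le_trans H _; rewrite -!addrA !lerD2l le_eqVlt; apply/orP; left; apply/eqP.
  rewrite -(natr1 n.+1); have : n.+1%:R != 0 :> R by rewrite pnatr_eq0.
  by move: (n.+1%:R) => m m0; field.
rewrite -/h; set c := L / 2 * _ in step *.
have c0 : 0 <= c by rewrite mulr_ge0 ?exprn_ge0 ?enorm_ge0// divr_ge0.
apply/ler_addgt0Pl => e e0.
have /= := truncnS_gt (c / e); set n := Num.truncn _ => Hn.
apply: le_trans (step n) _; rewrite addrC lerD2r.
by rewrite ler_pdivrMr// mulrC -ler_pdivrMr// ltW.
Qed.

(* Compare with the point y = xs - s g, where g is the gradient at xs: convexity
   at y and minimality give <gradient f y, g> <= 0, and the Lipschitz bound makes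
   this product at least (1 - L s) |g|^2. *)
Lemma gradient_minimizer {R : realType} {d} (f : 'rV[R]_d -> R) (L : R) xs :
  0 < L -> (forall x y, f x + dotv (gradient f x) (y - x) <= f y) ->
  lipschitz_gradient L f -> (forall x, f xs <= f x) -> gradient f xs = 0.
Proof.
move=> L0 fcvx fL fmin; set g := gradient f xs.
apply: enorm_eq0; apply/eqP; rewrite -[_ == 0]orbb -mulf_eq0 -expr2.
rewrite eq_le sqr_ge0 andbT.
(* Then [L * s] is 1/2, and half the squared norm of [g] is at most a nonpositive product. *)
pose s := (2 * L)^-1; have s0 : 0 < s by rewrite invr_gt0 mulr_gt0.
pose y := xs - s *: g.
have H1 : dotv (gradient f y) g <= 0.
  have := fcvx y xs; have := fmin y.
  rewrite /y opprB [X in dotv _ X]addrC subrK dotvZr -/y => h1 h2.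
  rewrite -(pmulr_rle0 _ s0); lra.
have : dotv (g - gradient f y) g <= L * s * enorm g ^+ 2.
  apply: le_trans (cauchy_schwarz _ _) _.
  rewrite expr2 mulrA; apply: ler_wpM2r; first exact: enorm_ge0.
  apply: le_trans (fL _ _) _.
  by rewrite /y opprB addrC subrK enormZ gtr0_norm// mulrA.
rewrite dotvDl dotvNl -sqr_enorm.
have -> : L * s = 1 / 2 by rewrite /s; field; rewrite gt_eqF.
lra.
Qed.

(* Add the strong convexity inequalities at (x, xs) and (xs, x). *)
Lemma strong_convexity_gradient {R : realType} {d} (f : 'rV[R]_d -> R) (mu : R) xs x :
  strongly_convex mu f -> gradient f xs = 0 ->
  mu * enorm (x - xs) <= enorm (gradient f x).
Proof.
move=> fsc g0; have [->|xN] := eqVneq (enorm (x - xs)) 0.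
  by rewrite mulr0 enorm_ge0.
have xp : 0 < enorm (x - xs) by rewrite lt_neqAle eq_sym xN enorm_ge0.
rewrite -(ler_pM2r xp).
have := fsc x xs; have := fsc xs x; rewrite g0.
have -> : dotv 0 (x - xs) = 0 by rewrite -(scale0r 0) dotvZl mul0r.
have := cauchy_schwarz (gradient f x) (x - xs).
rewrite -[xs - x]opprB enormN dotvNr; nra.
Qed.

Lemma convex_of_strongly_convex {R : realType} {d} (f : 'rV[R]_d -> R) (mu : R) :
  0 <= mu -> strongly_convex mu f ->
  forall x y, f x + dotv (gradient f x) (y - x) <= f y.
Proof.
move=> mu0 fsc x y; apply: le_trans (fsc x y); rewrite lerDl.
by rewrite mulr_ge0 ?exprn_ge0 ?enorm_ge0// divr_ge0.
Qed.

Lemma dist_stationaryE {R : realType} {d} (f : 'rV[R]_d -> R) (L mu : R) xs x0 :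
  0 < L -> lipschitz_gradient L f -> 0 < mu -> strongly_convex mu f ->
  (forall x, f xs <= f x) -> dist_stationary f x0 = enorm (x0 - xs) ^+ 2.
Proof.
move=> L0 fL mu0 fsc fmin.
have g0 := gradient_minimizer f L xs L0 (convex_of_strongly_convex f mu (ltW mu0) fsc) fL fmin.
rewrite /dist_stationary (_ : [set _ | _ in _] = [set enorm (x0 - xs) ^+ 2]) ?inf1//.
apply/seteqP; split => [_ [x /= gx <-]|_ -> /=]; last by exists xs.
have := strong_convexity_gradient f mu xs x fsc g0.
rewrite gx enorm0 pmulr_rle0// => h.
have /enorm_eq0/eqP : enorm (x - xs) = 0 by apply/eqP; rewrite eq_le h enorm_ge0.
by rewrite subr_eq0 => /eqP ->.
Qed.

Lemma inf_range_minimizer {R : realType} (T : Type) (f : T -> R) xs :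
  (forall x, f xs <= f x) -> inf (range f) = f xs.
Proof.
move=> fmin; apply/eqP; rewrite eq_le; apply/andP; split.
  by apply: ge_inf; [exists (f xs) => _ [x _ <-] | exists xs].
by apply: lb_le_inf => [|_ [x _ <-]//]; exists (f xs), xs.
Qed.

(** * Step-size sums *)

(* Weighted AM-GM: add expR y >= 1 + y at y = (1 - s) ln u and y = - s ln u with
   weights s and 1 - s. *)
Lemma powR_le_tangent {R : realType} (s u : R) :
  0 <= s <= 1 -> 0 < u -> u `^ s <= 1 + s * (u - 1).
Proof.
move=> /andP[s0 s1] u0; rewrite /powR gt_eqF//.
set v := expR (s * ln u); have v0 : 0 <= v by exact: expR_ge0.
have hu : v * (1 + (1 - s) * ln u) <= u.
  have E : u = v * expR ((1 - s) * ln u).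
    by rewrite -expRD -mulrDl addrC subrK mul1r lnK.
  rewrite [X in _ <= X]E.
  by rewrite ler_wpM2l// expR_ge1Dx.
have h1 : v * (1 - s * ln u) <= 1.
  have E : 1 = v * expR (- (s * ln u)) by rewrite -expRD subrr expR0.
  rewrite [X in _ <= X]E.
  by rewrite ler_wpM2l// expR_ge1Dx.
have {}s1 : 0 <= 1 - s by rewrite subr_ge0.
have := ler_wpM2l s0 hu; have := ler_wpM2l s1 h1; lra.
Qed.

(** The inequality [1 + y <= expR y] serves twice: at [y = s * ln u], and at [y = ln u], where it
    gives [ln u <= u - 1], reversed by the factor [s <= 0]. *)
Lemma powR_ge_tangent {R : realType} (s u : R) :
  s <= 0 -> 0 < u -> 1 + s * (u - 1) <= u `^ s.
Proof.
move=> s0 u0; rewrite /powR gt_eqF//; apply: le_trans (expR_ge1Dx _).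
rewrite lerD2l ler_wnM2l//.
by have := expR_ge1Dx (ln u); rewrite lnK//; lra.
Qed.

(** Factoring out the power of [x] turns the tangent inequality at 1, taken at [u = y / x], into the
    one at [x]. *)
Lemma powR_ratio {R : realType} (s x y : R) : 0 < x -> 0 < y ->
  y `^ s = x `^ s * (y / x) `^ s /\ x `^ s * (s * (y / x - 1)) = s * x `^ (s - 1) * (y - x).
Proof.
move=> x0 y0; split.
  by rewrite -powRM ?divr_ge0 ?ltW// mulrC divfK// gt_eqF.
rewrite powRD ?(gt_eqF x0) ?implybT// powR_inv1 ?ltW//.
by field; rewrite gt_eqF.
Qed.

Lemma powR_concave_tangent {R : realType} (s x y : R) : 0 <= s <= 1 ->
  0 < x -> 0 < y -> y `^ s <= x `^ s + s * x `^ (s - 1) * (y - x).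
Proof.
move=> s01 x0 y0; have [-> <-] := powR_ratio s x y x0 y0.
rewrite -[X in _ <= X + _]mulr1 -mulrDr ler_wpM2l ?powR_ge0//.
by rewrite powR_le_tangent// divr_gt0.
Qed.

Lemma powR_convex_tangent {R : realType} (s x y : R) : s <= 0 ->
  0 < x -> 0 < y -> x `^ s + s * x `^ (s - 1) * (y - x) <= y `^ s.
Proof.
move=> s0 x0 y0; have [-> <-] := powR_ratio s x y x0 y0.
rewrite -[X in X + _ <= _]mulr1 -mulrDr ler_wpM2l ?powR_ge0//.
by rewrite powR_ge_tangent// divr_gt0.
Qed.

(** A discrete comparison with the integral of x^(-q) over [1, +oo[: the tangent at k + 2 of the
    convex power 1 - q, evaluated at k + 1, bounds each term by a telescoping difference. *)
Lemma sum_powRN_le {R : realType} (q : R) (t : nat) :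
  1 < q -> \sum_(k < t) k.+2%:R `^ (- q) <= (q - 1)^-1.
Proof.
move=> q1; have qp : 0 < q - 1 by rewrite subr_gt0.
suff H : (q - 1) * \sum_(k < t) k.+2%:R `^ (- q) <= 1 - t.+1%:R `^ (1 - q).
  rewrite -(ler_pM2l qp) divff ?gt_eqF//; apply: le_trans H _.
  by rewrite gerBl powR_ge0.
elim: t => [|t IH]; first by rewrite big_ord0 mulr0 powR1 subrr.
rewrite big_ord_recr/= mulrDr.
have := @powR_convex_tangent R (1 - q) t.+2%:R t.+1%:R.
have -> : 1 - q - 1 = - q by ring.
have -> : 1 - q <= 0 by rewrite -oppr_ge0 opprB ltW.
rewrite !ltr0n => /(_ isT isT isT).
have -> : t.+1%:R - t.+2%:R = -1 :> R by rewrite -(natr1 t.+1); ring.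
lra.
Qed.

Lemma step_size_gt0 {R : realType} (a delta : R) t :
  0 < a -> 0 < step_size a delta t.
Proof. by move=> a0; rewrite divr_gt0// powR_gt0. Qed.

Lemma step_sizeE {R : realType} (a delta : R) t :
  step_size a delta t = a * t.+2%:R `^ (- delta).
Proof. by rewrite /step_size powRN. Qed.

(** The power [1 - delta] is concave, so its tangent at [t.+2] lies above its value at [t.+3]: each
    increment is at most [(1 - delta) / a] times a step size, and the increments telescope. *)
Lemma sum_step_size_ge {R : realType} (a delta : R) (t : nat) :
  0 < a -> 0 < delta < 1 ->
  a / (1 - delta) * (t.+2%:R `^ (1 - delta) - 2 `^ (1 - delta)) <=
  \sum_(k < t) step_size a delta k.
Proof.
move=> a0 /andP[d0 d1]; have dp : 0 < 1 - delta by rewrite subr_gt0.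
elim: t => [|t IH]; first by rewrite big_ord0 subrr mulr0.
rewrite big_ord_recr/= step_sizeE.
have := @powR_concave_tangent R (1 - delta) t.+2%:R t.+3%:R.
have -> : 1 - delta - 1 = - delta by ring.
have -> : 0 <= 1 - delta <= 1 by rewrite ltW//= gerBl ltW.
rewrite !ltr0n => /(_ isT isT isT).
have -> : t.+3%:R - t.+2%:R = 1 :> R by rewrite -(natr1 t.+2) addrC addKr.
rewrite mulr1 -lerBlDl => /(ler_wpM2l (ltW (divr_gt0 a0 dp))).
have -> : a / (1 - delta) * ((1 - delta) * t.+2%:R `^ (- delta)) =
   a * t.+2%:R `^ (- delta) by field; rewrite gt_eqF.
move: IH; lra.
Qed.

Lemma sum_step_size_le {R : realType} (a delta : R) (t : nat) :
  0 < a -> 0 < delta < 1 ->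
  \sum_(k < t) step_size a delta k <= a / (1 - delta) * t.+2%:R `^ (1 - delta).
Proof.
move=> a0 /andP[d0 d1]; have dp : 0 < 1 - delta by rewrite subr_gt0.
have ad := ltW (divr_gt0 a0 dp).
(* The tangent evaluated at [t.+1] gives a sharper bound by induction. It is relaxed to [t.+2], the
   base of the power in [step_size a delta t], so that the two powers can later be multiplied. *)
apply: (@le_trans _ _ (a / (1 - delta) * t.+1%:R `^ (1 - delta))); last first.
  by rewrite ler_wpM2l// ge0_ler_powR ?nnegrE ?ltW// ltr_nat.
elim: t => [|t IH]; first by rewrite big_ord0 mulr_ge0// powR_ge0.
rewrite big_ord_recr/= step_sizeE.
have := @powR_concave_tangent R (1 - delta) t.+2%:R t.+1%:R.
have -> : 1 - delta - 1 = - delta by ring.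
have -> : 0 <= 1 - delta <= 1 by rewrite ltW//= gerBl ltW.
rewrite !ltr0n => /(_ isT isT isT).
have -> : t.+1%:R - t.+2%:R = -1 :> R by rewrite -(natr1 t.+1); ring.
move=> /(ler_wpM2l ad).
have e : a / (1 - delta) * ((1 - delta) * t.+2%:R `^ (- delta)) =
   a * t.+2%:R `^ (- delta) by field; rewrite gt_eqF.
rewrite mulrN1 mulrBr e; move: IH; lra.
Qed.

Lemma sum_sqr_step_size {R : realType} (a delta : R) (t : nat) :
  1 / 2 < delta ->
  \sum_(k < t) step_size a delta k ^+ 2 <= a ^+ 2 / (2 * delta - 1).
Proof.
move=> d2; have := @sum_powRN_le R (2 * delta) t.
have -> : 1 < 2 * delta by lra.
move=> /(_ isT) /(ler_wpM2l (sqr_ge0 a)); apply: le_trans.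
rewrite mulr_sumr; apply: ler_sum => k _.
rewrite step_sizeE exprMn ler_wpM2l ?sqr_ge0//.
by rewrite -powR_mulrn ?powR_ge0// -powRrM mulNr mulrC.
Qed.

(** A step of order (k + 2)^(- delta) times a cumulative sum of order (k + 2)^(1 - delta) squares to
    the exponent - (4 delta - 2), summable since [delta] exceeds 3/4. *)
Lemma sum_sqr_step_size_cumulative {R : realType} (a delta : R) (t : nat) :
  0 < a -> 3 / 4 < delta < 1 ->
  \sum_(k < t) (step_size a delta k * \sum_(j < k) step_size a delta j) ^+ 2 <=
  a ^+ 4 / ((1 - delta) ^+ 2 * (4 * delta - 3)).
Proof.
move=> a0 /andP[d0 d1]; have := @sum_powRN_le R (4 * delta - 2) t.
have -> : 1 < 4 * delta - 2 by lra.
have c0 : 0 <= (a ^+ 2 / (1 - delta)) ^+ 2 by exact: sqr_ge0.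
move=> /(_ isT) /(ler_wpM2l c0).
have -> : (a ^+ 2 / (1 - delta)) ^+ 2 * (4 * delta - 2 - 1)^-1 =
   a ^+ 4 / ((1 - delta) ^+ 2 * (4 * delta - 3)).
  by field; rewrite !gt_eqF//; lra.
apply: le_trans; rewrite mulr_sumr; apply: ler_sum => k _.
have dp : 0 < 1 - delta by rewrite subr_gt0.
have -> : - (4 * delta - 2) = (1 - 2 * delta) * 2%:R by ring.
rewrite powRrM powR_mulrn ?powR_ge0// -exprMn.
have S0 : 0 <= \sum_(j < k) step_size a delta j.
  by apply: sumr_ge0 => j _; exact: ltW (step_size_gt0 _ _ _ a0).
have ak := ltW (step_size_gt0 a delta k a0).
rewrite ler_sqr ?nnegrE; last 2 first.
- exact: mulr_ge0.
- by rewrite mulr_ge0 ?powR_ge0// divr_ge0 ?sqr_ge0// ltW.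
have d01 : 0 < delta < 1 by apply/andP; split => //; lra.
apply: le_trans (ler_wpM2l ak (sum_step_size_le a delta k a0 d01)) _.
rewrite step_sizeE mulrACA -powRD; last by rewrite pnatr_eq0 implybT.
have -> : - delta + (1 - delta) = 1 - 2 * delta by ring.
by rewrite mulrA expr2.
Qed.

(** * Huber loss *)

(** The difference is [(r - c) ^+ 2 / 2] on the quadratic branch and [(lam - c) * (r - lam) + (lam -
    c) ^+ 2 / 2] on the linear one. *)
Lemma huber_ge {R : realType} (lam c r : R) : 0 <= c <= lam -> 0 <= r ->
  c * r - c ^+ 2 / 2 <= huber lam r.
Proof.
move=> /andP[c0 cl] r0; rewrite /huber ger0_norm//.
case: (lerP r lam) => h; first by have := sqr_ge0 (r - c); lra.
have : 0 <= (lam - c) * (r - lam) by apply: mulr_ge0; rewrite subr_ge0// ltW.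
by have := sqr_ge0 (lam - c); lra.
Qed.

(** The slope is the derivative of the loss at [r], the smaller of [r] and [lam]. *)
Lemma huber_attained {R : realType} (lam r : R) : 0 <= lam -> 0 <= r ->
  exists2 c, 0 <= c <= lam & huber lam r = c * r - c ^+ 2 / 2.
Proof.
move=> l0 r0; rewrite /huber ger0_norm//; case: (lerP r lam) => h.
  by exists r; [rewrite r0 | field].
by exists lam; [rewrite l0 lexx |].
Qed.

(* The Huber loss is the supremum over 0 <= c <= lam of the affine functions
   c r - c^2 / 2 (with nonnegative slopes), hence convex and nondecreasing. *)
Lemma huber_jensen {R : realType} (lam s : R) (n : nat) (w r : 'I_n -> R) :
  0 <= lam -> (forall k, 0 <= w k) -> \sum_k w k = 1 -> (forall k, 0 <= r k) ->
  0 <= s <= \sum_k w k * r k ->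
  huber lam s <= \sum_k w k * huber lam (r k).
Proof.
move=> l0 w0 w1 r0 /andP[s0 sr].
have [c c0l ->] := huber_attained lam s l0 s0.
apply: (@le_trans _ _ (\sum_k w k * (c * r k - c ^+ 2 / 2))); last first.
  by apply: ler_sum => k _; rewrite ler_wpM2l// huber_ge.
under eq_bigr do rewrite mulrBr mulrCA.
rewrite sumrB -mulr_sumr -mulr_suml w1 mul1r lerD2r ler_wpM2l//.
by case/andP: c0l.
Qed.

(** This gives the loss the linear-or-quadratic shape of the lower bound on <Phi(x), x>. *)
Lemma huber_le_min {R : realType} (lam r : R) : 0 <= lam -> 0 <= r ->
  huber lam r <= Num.min (lam * r) (r ^+ 2).
Proof.
move=> l0 r0; rewrite /huber ger0_norm// le_min.
by case: (lerP r lam) => h; apply/andP; split; nra.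
Qed.

(** * Bound along a trajectory *)

Lemma huber_ge0 {R : realType} (lam r : R) : 0 <= lam -> 0 <= r -> 0 <= huber lam r.
Proof.
move=> l0 r0; apply: le_trans (huber_ge lam 0 r _ r0); last by rewrite lexx.
by rewrite mul0r expr0n/= mul0r subrr.
Qed.

(** [F] plays the part of [Phi] and [y k] that of the noisy gradient. The descent inequality of each
    step is split by Psi = F - (F - Psi); boundedness of the nonlinearity controls the quadratic
    term, and the values of [f] telescope. *)
Lemma sgd_descent_sum {R : realType} {d} (f : 'rV[R]_d -> R) (L C1 : R)
    (N1 : R -> R) (F : 'rV[R]_d -> 'rV[R]_d) (alpha : nat -> R)
    (x y : nat -> 'rV[R]_d) (t : nat) :
  0 < L -> (forall u v, f u + dotv (gradient f u) (v - u) <= f v) ->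
  lipschitz_gradient L f -> (forall s, `|N1 s| <= C1) ->
  (forall k, x k.+1 = x k - alpha k *: Psi N1 (y k)) ->
  \sum_(k < t) alpha k * dotv (F (gradient f (x k))) (gradient f (x k)) <=
  f (x 0%N) - f (x t)
  + \sum_(k < t) alpha k * dotv (gradient f (x k))
                             (F (gradient f (x k)) - Psi N1 (y k))
  + d%:R * L * C1 ^+ 2 / 2 * \sum_(k < t) alpha k ^+ 2.
Proof.
move=> L0 fcvx fL NC xS; elim: t => [|t IH].
  by rewrite !big_ord0 subrr mulr0 !addr0.
rewrite !big_ord_recr/= mulrDr.
have := descent f L (ltW L0) fcvx fL (x t) (x t.+1).
have -> : x t.+1 - x t = - (alpha t *: Psi N1 (y t)) by rewrite xS addrAC subrr add0r.
rewrite enormN enormZ exprMn real_normK ?num_real// !(dotvNr, dotvDr, dotvZr).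
rewrite [dotv (F _) _]dotvC.
have := ler_wpM2l (sqr_ge0 (alpha t)) (sqr_enorm_Psi N1 C1 (y t) NC).
move=> /(ler_wpM2l (ltW L0)).
move: IH; lra.
Qed.

Lemma sgd_drift {R : realType} {d} (C1 : R) (N1 : R -> R) (alpha : nat -> R)
    (x y : nat -> 'rV[R]_d) (xs : 'rV[R]_d) (t : nat) :
  (forall k, 0 <= alpha k) -> (forall s, `|N1 s| <= C1) ->
  (forall k, x k.+1 = x k - alpha k *: Psi N1 (y k)) ->
  enorm (x t - xs) <=
  enorm (x 0%N - xs) + Num.sqrt (d%:R * C1 ^+ 2) * \sum_(k < t) alpha k.
Proof.
move=> a0 NC xS; elim: t => [|t IH]; first by rewrite big_ord0 mulr0 addr0.
rewrite big_ord_recr/= xS addrAC; apply: le_trans (enormD _ _) _.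
rewrite enormN enormZ ger0_norm// mulrDr addrA; apply: lerD => //.
rewrite mulrC ler_wpM2r// -(ger0_norm (enorm_ge0 _)) -sqrtr_sqr ler_wsqrtr//.
exact: sqr_enorm_Psi.
Qed.

(** As the gradient vanishes at [xs], its norm at [x k] is at most [L] times the drift bound.
    Squaring with (u + v)^2 <= 2 u^2 + 2 v^2 leaves the two step-size series bounded above. *)
Lemma sum_sqr_step_gradient {R : realType} {d} (f : 'rV[R]_d -> R) (L C1 a delta : R)
    (N1 : R -> R) (x y : nat -> 'rV[R]_d) (xs : 'rV[R]_d) (t : nat) :
  0 < a -> 3 / 4 < delta < 1 -> 0 < L ->
  lipschitz_gradient L f -> gradient f xs = 0 -> (forall s, `|N1 s| <= C1) ->
  (forall k, x k.+1 = x k - step_size a delta k *: Psi N1 (y k)) ->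
  \sum_(k < t) step_size a delta k ^+ 2 * enorm (gradient f (x k)) ^+ 2 <=
  2 * L ^+ 2 * enorm (x 0%N - xs) ^+ 2 * (a ^+ 2 / (2 * delta - 1)) +
  2 * L ^+ 2 * (d%:R * C1 ^+ 2) * (a ^+ 4 / ((1 - delta) ^+ 2 * (4 * delta - 3))).
Proof.
move=> a0 d01 L0 fL g0 NC xS.
have al0 k := ltW (step_size_gt0 a delta k a0).
have dC : 0 <= d%:R * C1 ^+ 2 by rewrite mulr_ge0 ?sqr_ge0.
have c0 : 0 <= 2 * L ^+ 2 by rewrite mulr_ge0 ?sqr_ge0.
have := ler_wpM2l (mulr_ge0 c0 dC) (sum_sqr_step_size_cumulative a delta t a0 d01).
have d2 : 1 / 2 < delta by case/andP: d01; lra.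
have := ler_wpM2l (mulr_ge0 c0 (sqr_ge0 (enorm (x 0%N - xs)))) (sum_sqr_step_size a delta t d2).
move=> h1 h2; apply: le_trans (lerD h1 h2).
rewrite !mulr_sumr -big_split/=; apply: ler_sum => k _.
set A := \sum_(j < k) _; set al := step_size a delta k; set D := enorm (x 0%N - xs).
have A0 : 0 <= A by exact: sumr_ge0.
suff H : enorm (gradient f (x k)) ^+ 2 <=
    2 * L ^+ 2 * D ^+ 2 + 2 * L ^+ 2 * (d%:R * C1 ^+ 2) * A ^+ 2.
  by apply: le_trans (ler_wpM2l (sqr_ge0 al) H) _; rewrite le_eqVlt; apply/orP; left; apply/eqP; ring.
set c := Num.sqrt (d%:R * C1 ^+ 2).
have -> : d%:R * C1 ^+ 2 = c ^+ 2 by rewrite sqr_sqrtr.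
have H : enorm (gradient f (x k)) <= L * (D + c * A).
  rewrite -[gradient f (x k)]subr0 -g0; apply: le_trans (fL _ _) _.
  by rewrite ler_wpM2l ?(ltW L0)//; exact: (sgd_drift C1 N1 (step_size a delta) x y).
have : enorm (gradient f (x k)) ^+ 2 <= (L * (D + c * A)) ^+ 2.
  by rewrite lerXn2r ?nnegrE ?enorm_ge0// (le_trans _ H)// enorm_ge0.
have := mulr_ge0 (sqr_ge0 L) (sqr_ge0 (D - c * A)); lra.
Qed.

Lemma sqrt_natM {R : realType} d : Num.sqrt d%:R * Num.sqrt d%:R = d%:R :> R.
Proof. by rewrite -expr2 sqr_sqrtr. Qed.

(** The prefactor times [phi0 / 2] is d / mu^2. With lam = xi sqrt(d) / mu, it turns the two
    arguments of the minimum into lam rho and rho^2, where rho = |u| / mu >= r; these dominate the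
    two bounds of [huber_le_min]. *)
Lemma huber_le_correlation {R : realType} {d} (hd : (0 < d)%N) (mu phi0 xi r : R)
    (u v : 'rV[R]_d) :
  0 < mu -> 0 < phi0 -> 0 < xi -> 0 <= r -> mu * r <= enorm u ->
  phi0 / 2 * Num.min (xi * enorm u / Num.sqrt d%:R) (enorm u ^+ 2 / d%:R) <= dotv v u ->
  huber (xi * Num.sqrt d%:R / mu) r <= 2 * d%:R / (mu ^+ 2 * phi0) * dotv v u.
Proof.
move=> mu0 p0 xi0 r0 ru uv.
have sd : 0 < Num.sqrt d%:R :> R by rewrite sqrtr_gt0 ltr0n.
have dE : d%:R = Num.sqrt d%:R ^+ 2 :> R by rewrite expr2 sqrt_natM.
have dp : 0 < d%:R :> R by rewrite ltr0n.
set s := Num.sqrt d%:R in sd dE uv *.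
have l0 : 0 <= xi * s / mu by rewrite divr_ge0 ?mulr_ge0 ?ltW.
apply: le_trans (huber_le_min _ _ l0 r0) _.
have K0 : 0 <= 2 * d%:R / (mu ^+ 2 * phi0).
  by rewrite divr_ge0 ?mulr_ge0 ?sqr_ge0// ltW.
apply: le_trans (ler_wpM2l K0 uv); rewrite mulrA.
have -> : 2 * d%:R / (mu ^+ 2 * phi0) * (phi0 / 2) = d%:R / mu ^+ 2.
  by field; rewrite !gt_eqF.
rewrite minr_pMr; last by rewrite divr_ge0 ?sqr_ge0// ltW.
rewrite le_min !ge_min; apply/andP; split; apply/orP; [left|right].
  have -> : d%:R / mu ^+ 2 * (xi * enorm u / s) = xi * s / mu * (enorm u / mu).
    by rewrite dE; field; rewrite !gt_eqF.
  by rewrite ler_wpM2l// ler_pdivlMr// mulrC.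
have -> : d%:R / mu ^+ 2 * (enorm u ^+ 2 / d%:R) = (enorm u / mu) ^+ 2.
  by field; rewrite !gt_eqF.
have rm : r <= enorm u / mu by rewrite ler_pdivlMr// mulrC.
by rewrite lerXn2r ?nnegrE// (le_trans r0).
Qed.

Lemma weighted_average_dist {R : realType} {d} (alpha : nat -> R)
    (x : nat -> 'rV[R]_d) (xs : 'rV[R]_d) (t : nat) :
  (forall k, 0 < alpha k) -> (0 < t)%N ->
  \sum_(k < t) alpha k / (\sum_(j < t) alpha j) = 1 /\
  enorm (weighted_average alpha x t - xs) <=
  \sum_(k < t) alpha k / (\sum_(j < t) alpha j) * enorm (x k - xs).
Proof.
move=> a0 t0; set A := \sum_(j < t) alpha j.
have A0 : 0 < A.
  rewrite /A; case: t t0 {A} => // t _; rewrite big_ord_recr/= ltr_wpDl//.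
  by apply: sumr_ge0 => k _; exact: ltW.
have w1 : \sum_(k < t) alpha k / A = 1 by rewrite -mulr_suml divff// gt_eqF.
split => //; rewrite /weighted_average -/A.
have -> : \sum_(k < t) (alpha k / A) *: x k - xs =
    \sum_(k < t) (alpha k / A) *: (x k - xs).
  rewrite -[xs in LHS]scale1r -w1 scaler_suml -sumrB.
  by apply: eq_bigr => k _; rewrite scalerBr.
apply: le_trans (enorm_sum _ _ _) _; apply: ler_sum => k _.
by rewrite enormZ ger0_norm// divr_ge0 ?ltW.
Qed.

(** Randomness enters only through the last hypothesis, a bound on the compensated noise sum. The
    theorem is thereby reduced to the probability of that single event. *)
Lemma sgd_deterministic {R : realType} {d} (hd : (0 < d)%N) (f : 'rV[R]_d -> R)
    (L mu C1 N phi0 xi a delta beta : R) (N1 : R -> R)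
    (F : 'rV[R]_d -> 'rV[R]_d) (x y : nat -> 'rV[R]_d) (xs : 'rV[R]_d) (t : nat) :
  0 < L -> lipschitz_gradient L f -> 0 < mu -> strongly_convex mu f ->
  (forall u, f xs <= f u) -> (forall s, `|N1 s| <= C1) ->
  0 < phi0 -> 0 < xi ->
  (forall u : 'rV[R]_d, phi0 / 2
      * Num.min (xi * enorm u / Num.sqrt d%:R) (enorm u ^+ 2 / d%:R)
    <= dotv (F u) u) ->
  0 < a -> 3 / 4 < delta < 1 -> 0 <= N -> (0 < t)%N ->
  (forall k, x k.+1 = x k - step_size a delta k *: Psi N1 (y k)) ->
  \sum_(k < t) (step_size a delta k * dotv (gradient f (x k))
                             (F (gradient f (x k)) - Psi N1 (y k))
      - N * (step_size a delta k ^+ 2 * enorm (gradient f (x k)) ^+ 2))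
    <= ln (1 / beta) ->
  huber (xi * Num.sqrt d%:R / mu)
    (enorm (weighted_average (step_size a delta) x t - xs)) <=
  R_tilde d mu L C1 N phi0 (f (x 0%N) - f xs) (enorm (x 0%N - xs) ^+ 2) a beta delta
    / (t.+2%:R `^ (1 - delta) - 2 `^ (1 - delta)).
Proof.
move=> L0 fL mu0 fsc fmin NC p0 xi0 FP a0 d01 N0 t0 xS HS.
have fcvx := convex_of_strongly_convex f mu (ltW mu0) fsc.
have g0 := gradient_minimizer f L xs L0 fcvx fL fmin.
have /andP[d34 d1] := d01.
have d1' : 0 < 1 - delta by rewrite subr_gt0.
have al0 k : 0 < step_size a delta k by exact: step_size_gt0.
set lam := xi * Num.sqrt d%:R / mu.
have lam0 : 0 <= lam by rewrite divr_ge0 ?mulr_ge0 ?sqrtr_ge0 ?ltW.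
have H1 := sgd_descent_sum f L C1 N1 F (step_size a delta) x y t L0 fcvx fL NC xS.
have H2 := ler_wpM2l N0
  (sum_sqr_step_gradient f L C1 a delta N1 x y xs t a0 d01 L0 fL g0 NC xS).
have d2 : 1 / 2 < delta by lra.
have c0 : 0 <= d%:R * L * C1 ^+ 2 / 2 by rewrite divr_ge0// mulr_ge0 ?sqr_ge0// mulr_ge0// ltW.
have H3 := ler_wpM2l c0 (sum_sqr_step_size a delta t d2).
move: HS; rewrite sumrB -mulr_sumr => HS.
set B := (f (x 0%N) - f xs + ln (1 / beta)) / a
   + a * (d%:R * L * C1 ^+ 2 / 2 + 2 * N * L ^+ 2 * enorm (x 0%N - xs) ^+ 2) / (2 * delta - 1)
   + 2 * a ^+ 3 * d%:R * N * C1 ^+ 2 * L ^+ 2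
       / ((1 - delta) ^+ 2 * (4 * delta - 3)).
(* The noise sum is at most [ln (1 / beta)] plus the compensator, which [H2] bounds; [f (x t)] is
   replaced by the minimum [f xs]. *)
have aB : \sum_(k < t) step_size a delta k *
    dotv (F (gradient f (x k))) (gradient f (x k)) <= a * B.
  apply: le_trans H1 _; have := fmin (x t).
  have -> : a * B = f (x 0%N) - f xs + ln (1 / beta) +
     d%:R * L * C1 ^+ 2 / 2 * (a ^+ 2 / (2 * delta - 1)) +
     N * (2 * L ^+ 2 * enorm (x 0%N - xs) ^+ 2 * (a ^+ 2 / (2 * delta - 1)) +
  2 * L ^+ 2 * (d%:R * C1 ^+ 2) * (a ^+ 4 / ((1 - delta) ^+ 2 * (4 * delta - 3)))).
    rewrite /B; field; rewrite !gt_eqF//; lra.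
  move: H2 H3 HS; lra.
set K := 2 * d%:R / (mu ^+ 2 * phi0).
have K0 : 0 <= K by rewrite divr_ge0 ?mulr_ge0 ?sqr_ge0// ltW.
have Hh : \sum_(k < t) step_size a delta k * huber lam (enorm (x k - xs)) <= K * (a * B).
  apply: le_trans (ler_wpM2l K0 aB); rewrite mulr_sumr; apply: ler_sum => k _.
  rewrite mulrCA ler_wpM2l ?(ltW (al0 _))//.
  apply: (huber_le_correlation hd mu phi0 xi) => //; first exact: enorm_ge0.
  exact: (strong_convexity_gradient f mu).
have [w1 wd] := weighted_average_dist (step_size a delta) x xs t al0 t0.
set A := \sum_(j < t) step_size a delta j in w1 wd.
have d01' : 0 < delta < 1 by rewrite d1 andbT; lra.
have HA : a / (1 - delta) * _ <= A := sum_step_size_ge a delta t a0 d01'.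
set Dl := t.+2%:R `^ (1 - delta) - 2 `^ (1 - delta) in HA *.
have Dl0 : 0 < Dl by rewrite subr_gt0 gt0_ltr_powR ?nnegrE// ltr_nat.
have aD : 0 < a / (1 - delta) * Dl by rewrite mulr_gt0// divr_gt0.
have A0 : 0 < A by exact: lt_le_trans HA.
apply: (@le_trans _ _ (K * (a * B) / A)).
  have w0 (k : 'I_t) : 0 <= step_size a delta k / A by rewrite divr_ge0 ?ltW.
  apply: le_trans (huber_jensen lam _ _ (fun k : 'I_t => step_size a delta k / A)
    (fun k => enorm (x k - xs)) lam0 w0 w1 _ _) _.
  - by move=> k; exact: enorm_ge0.
  - by rewrite enorm_ge0.
  rewrite ler_pdivlMr// mulr_suml; apply: le_trans Hh.
  apply: ler_sum => k _; rewrite le_eqVlt; apply/orP; left; apply/eqP.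
  by field; rewrite gt_eqF.
(* Nonnegativity of the numerator, inherited from the Huber losses, lets [A] be replaced by its
   lower bound in the denominator. *)
have KB0 : 0 <= K * (a * B).
  apply: le_trans Hh; apply: sumr_ge0 => k _.
  by rewrite mulr_ge0 ?(ltW (al0 _))// huber_ge0// enorm_ge0.
apply: (@le_trans _ _ (K * (a * B) / (a / (1 - delta) * Dl))).
  by rewrite ler_wpM2l// lef_pV2 ?posrE.
rewrite /R_tilde -/B le_eqVlt; apply/orP; left; apply/eqP.
by rewrite /K; field; rewrite !gt_eqF.
Qed.

(** * Measurability *)

Lemma measurable_rV_entry {R : realType} {d} {dT} {T : measurableType dT}
    (X : T -> 'rV[R]_d) (i : 'I_d) :
  measurable_fun setT X -> measurable_fun setT (fun t => X t 0 i).
Proof.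
move=> mX; apply: (@measurableT_comp _ _ _ _ _ _ (fun x : 'rV[R]_d => x 0 i)) => //.
exact: measurable_rV_coord.
Qed.

Lemma measurable_dotv {R : realType} {d} {dT} {T : measurableType dT}
    (X Y : T -> 'rV[R]_d) :
  measurable_fun setT X -> measurable_fun setT Y ->
  measurable_fun setT (fun t => dotv (X t) (Y t)).
Proof.
move=> mX mY; apply: measurable_sum => i.
by apply: measurable_funM; exact: measurable_rV_entry.
Qed.

Lemma measurable_enorm {R : realType} {d} {dT} {T : measurableType dT}
    (X : T -> 'rV[R]_d) :
  measurable_fun setT X -> measurable_fun setT (fun t => enorm (X t)).
Proof.
move=> mX; rewrite /enorm.
have ms : measurable_fun setT (Num.sqrt : R -> R).
  by apply: continuous_measurable_fun; exact: sqrt_continuous.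
exact: (measurableT_comp ms (measurable_dotv X X mX mX)).
Qed.

Lemma measurable_rVD {R : realType} {d} {dT} {T : measurableType dT}
    (X Y : T -> 'rV[R]_d) :
  measurable_fun setT X -> measurable_fun setT Y ->
  measurable_fun setT (fun t => X t + Y t).
Proof.
move=> mX mY; apply: measurable_fun_rV => i; under eq_fun do rewrite mxE.
by apply: measurable_funD; exact: measurable_rV_entry.
Qed.

Lemma measurable_rVZ {R : realType} {d} {dT} {T : measurableType dT}
    (c : R) (X : T -> 'rV[R]_d) :
  measurable_fun setT X -> measurable_fun setT (fun t => c *: X t).
Proof.
move=> mX; apply: measurable_fun_rV => i; under eq_fun do rewrite mxE.
by apply: measurable_funM => //; exact: measurable_rV_entry.
Qed.

Lemma measurable_rVB {R : realType} {d} {dT} {T : measurableType dT}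
    (X Y : T -> 'rV[R]_d) :
  measurable_fun setT X -> measurable_fun setT Y ->
  measurable_fun setT (fun t => X t - Y t).
Proof.
move=> mX mY; apply: measurable_rVD => //.
by under eq_fun do rewrite -scaleN1r; exact: measurable_rVZ.
Qed.

Lemma enorm_le_coord {R : realType} {d} (x : 'rV[R]_d) (e : R) :
  (forall i, `|x 0 i| <= e) -> enorm x <= d%:R * e.
Proof.
(* When [d] is 0 the hypothesis leaves the sign of [e] open, but both sides vanish. *)
move=> xe; have [d0|d0] := posnP d.
  by subst d; rewrite /enorm /dotv big_ord0 sqrtr0 mul0r.
have e0 : 0 <= e by apply: le_trans (xe (Ordinal d0)).
rewrite -ler_sqr ?nnegrE ?enorm_ge0 ?mulr_ge0// sqr_enorm.
apply: (@le_trans _ _ (\sum_(i < d) e ^+ 2)).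
  apply: ler_sum => i _; rewrite -expr2 -real_normK ?num_real//.
  by rewrite lerXn2r ?nnegrE.
rewrite sumr_const card_ord -[e ^+ 2 *+ _]mulr_natl exprMn ler_wpM2r ?sqr_ge0//.
by rewrite -natrX ler_nat -mulnn leq_pmulr.
Qed.

Lemma coord_le_enorm {R : realType} {d} (x : 'rV[R]_d) i : `|x 0 i| <= enorm x.
Proof.
rewrite -ler_sqr ?nnegrE ?enorm_ge0// sqr_enorm real_normK ?num_real//.
rewrite /dotv (bigD1 i)//= -expr2 lerDl.
by apply: sumr_ge0 => j _; rewrite -expr2 sqr_ge0.
Qed.

Lemma rat_rV_dense {R : realType} {d} (x : 'rV[R]_d) (e : R) : 0 < e ->
  exists q : 'rV[rat]_d, enorm (x - map_mx ratr q) < e.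
Proof.
(* Dividing by [d.+1] leaves room for the strict inequality and covers [d = 0]. *)
move=> e0; pose h := e / d.+1%:R; have h0 : 0 < h by rewrite divr_gt0.
have H i : exists q : rat, ratr q \in `]x 0 i - h, x 0 i + h[.
  by apply: rat_in_itvoo; rewrite ltrD2l gtrN.
exists (\row_i projT1 (cid (H i))).
apply: (@le_lt_trans _ _ (d%:R * h)); last first.
  rewrite /h mulrCA gtr_pMr// ltr_pdivrMr// mul1r ltr_nat//.
apply: enorm_le_coord => i; rewrite !mxE; case: cid => q /=.
by rewrite in_itv/= => /andP[h1 h2]; rewrite ler_norml; apply/andP; split; lra.
Qed.

(* The McShane formula [g x = sup_q (g q - L |x - q|)] over rational points q
   turns Lipschitz continuity into measurability for the coordinate
   sigma-algebra. *)
Lemma measurable_lipschitz {R : realType} {d} (g : 'rV[R]_d -> R) (L : R) :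
  0 < L -> (forall x y, `|g x - g y| <= L * enorm (x - y)) -> measurable_fun setT g.
Proof.
move=> L0 gL mT; apply: (measurability _ (RGenOInfty.measurableE R)) => //.
move=> /= _ [_ [c ->] <-]; rewrite setTI.
rewrite (_ : _ @^-1` _ = \bigcup_(q : 'rV[rat]_d)
   ((fun x => g (map_mx ratr q) - L * enorm (x - map_mx ratr q)) @^-1` `]c, +oo[)).
  apply: countable_bigcupT_measurable => [|q]; first exact: countableP.
  have mh : measurable_fun setT
      (fun x : 'rV[R]_d => g (map_mx ratr q) - L * enorm (x - map_mx ratr q)).
    apply: measurable_funB => //; apply: measurable_funM => //.
    by apply: measurable_enorm; exact: measurable_rVB.
  by rewrite -[X in measurable X]setTI; exact: mh.
apply/seteqP; split => x /=.
  rewrite in_itv/= andbT => cx.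
  (* For [q] within this radius of [x], g(q) - L |x - q| >= g(x) - 2 L |x - q| > c. *)
  have e0 : 0 < (g x - c) / (2 * L) by rewrite divr_gt0 ?subr_gt0 ?mulr_gt0.
  have [q qx] := rat_rV_dense x _ e0; exists q => //=.
  move: qx; rewrite in_itv/= andbT ltr_pdivlMr ?mulr_gt0// => qx.
  by have := gL x (map_mx ratr q); rewrite ler_norml => /andP[_]; lra.
move=> [q _] /=; rewrite !in_itv/= !andbT => cq.
by have := gL x (map_mx ratr q); rewrite ler_norml => /andP[]; lra.
Qed.

Lemma measurable_gradient {R : realType} {d} (f : 'rV[R]_d -> R) (L : R) :
  0 < L -> lipschitz_gradient L f -> measurable_fun setT (gradient f).
Proof.
move=> L0 fL; apply: measurable_fun_rV => i.
apply: (measurable_lipschitz _ L) => // x y.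
apply: le_trans (fL x y); have := coord_le_enorm (gradient f x - gradient f y) i.
by rewrite !mxE.
Qed.

Lemma measurable_Psi {R : realType} {d} (N1 : R -> R) :
  {homo N1 : x y / x <= y} -> measurable_fun setT (@Psi R d N1).
Proof.
move=> N1nd; apply: measurable_fun_rV => i; under eq_fun do rewrite mxE.
apply: (@measurableT_comp _ _ _ _ _ _ N1); last exact: measurable_rV_coord.
exact: nondecreasing_measurable.
Qed.

(** Coordinate [i] depends on [x] only through [x 0 i], and monotonically so, being an integral of
    nondecreasing functions; monotonicity gives measurability. Boundedness of [N1] makes the
    compared integrals finite. *)
Lemma measurable_Phi {R : realType} {d} (N1 : R -> R) (C1 : R) (p : 'rV[R]_d -> R) :
  {homo N1 : x y / x <= y} -> (forall s, `|N1 s| <= C1) ->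
  (forall u, 0 <= p u) -> (lebesgue_rV R d).-integrable setT (EFin \o p) ->
  measurable_fun setT (Phi N1 p).
Proof.
move=> N1nd NC p0 ip; apply: measurable_fun_rV => i.
have mN1 : measurable_fun setT N1 by exact: nondecreasing_measurable.
have mp : measurable_fun setT p by apply/measurable_EFinP; case/integrableP: ip.
have intN s : (lebesgue_rV R d).-integrable setT
    (EFin \o (fun u : 'rV[R]_d => N1 (s + u 0 i) * p u)).
  apply: (le_integrable measurableT _ _ (integrableZl measurableT C1 ip)) => //.
    apply/measurable_EFinP; apply: measurable_funM => //.
    apply: (@measurableT_comp _ _ _ _ _ _ N1) => //.
    by apply: measurable_funD => //; exact: measurable_rV_coord.
  move=> u _ /=; rewrite lee_fin normrM [leRHS]normrM.
  rewrite ler_wpM2r//; exact: le_trans (NC _) (ler_norm _).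
rewrite (_ : (fun x => _) = (fun s => \int[lebesgue_rV R d]_u (N1 (s + u 0 i) * p u)) \o
    (fun x : 'rV[R]_d => x 0 i)); last first.
  by apply/funext => x /=; rewrite mxE; apply: eq_Rintegral => u _; rewrite !mxE.
apply: measurableT_comp; last exact: measurable_rV_coord.
apply: nondecreasing_measurable => // s s' ss'.
apply: le_Rintegral => // u _; rewrite ler_wpM2r// N1nd// lerD2r//.
Qed.

Lemma measurable_huber {R : realType} (lam : R) : measurable_fun setT (huber lam).
Proof.
apply: measurable_fun_ifT.
- by apply: measurable_fun_ler => //; exact: normr_measurable.
- by apply: measurable_funM => //; apply: measurable_funX.
- by apply: measurable_funB => //; apply: measurable_funM => //; exact: normr_measurable.
Qed.

(** The domain [T] is arbitrary and only the noise before time [t] is assumed measurable: equipping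
    the sample space with the sigma-algebra of the past yields adaptedness of the iterates. *)
Lemma measurable_sgd {R : realType} {d} {dT} {T : measurableType dT}
    (f : 'rV[R]_d -> R) (N1 : R -> R) (alpha : nat -> R) x0
    (z : nat -> T -> 'rV[R]_d) (t : nat) :
  measurable_fun setT (gradient f) -> measurable_fun setT (@Psi R d N1) ->
  (forall k, (k < t)%N -> measurable_fun setT (z k)) ->
  measurable_fun setT (sgd f N1 alpha x0 z t).
Proof.
move=> mg mP; elim: t => [|t IH] mz; first exact: measurable_cst.
have {}IH := IH (fun k kt => mz k (ltnW kt)).
apply: measurable_rVB => //; apply: measurable_rVZ; apply: (measurableT_comp mP).
by apply: measurable_rVD; [exact: measurableT_comp | exact: mz].
Qed.

(** * Exponential supermartingale *)

Lemma measurable_fun_sub {dT dU} {T : measurableType dT} {U : measurableType dU}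
    (G : set (set T)) (h : T -> U) :
  <<s G >> `<=` @measurable dT T ->
  @measurable_fun _ _ (g_sigma_algebraType G) U setT h -> measurable_fun setT h.
Proof. by move=> Gm mh _ A mA; apply: Gm; exact: mh. Qed.

(** The level sets of [h] lie in the sub-sigma-algebra, so the weighted integral becomes a finite
    combination of integrals over sets to which a conditional bound applies. *)
Lemma integral_nnsfun_mul {R : realType} {dT} {T : measurableType dT}
    (mu : {measure set T -> \bar R}) (G : set (set T))
    (h : {nnsfun g_sigma_algebraType G >-> R}) (Y : T -> R) :
  <<s G >> `<=` @measurable dT T ->
  measurable_fun setT Y -> (forall w, 0 <= Y w) ->
  (\int[mu]_w (h w * Y w)%:E =
   \sum_(r \in range h) r%:E * \int[mu]_(w in h @^-1` [set r]) (Y w)%:E)%E.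
Proof.
move=> Gm mY Y0.
have mh r : measurable (h @^-1` [set r] : set T).
  by apply: Gm; exact: (measurable_funPTI h (measurable_set1 r)).
have hr0 r w : 0 <= r * \1_(h @^-1` [set r]) w.
  rewrite indicE; case: (boolP (w \in _)) => [|_]; last by rewrite mulr0.
  by rewrite inE /= => <-; rewrite mulr1.
transitivity (\int[mu]_w (\sum_(r \in range h)
    (r * \1_(h @^-1` [set r]) w * Y w)%:E))%E.
  apply: eq_integral => w _; rewrite fsumEFin//; congr EFin.
  by rewrite -mulr_fsuml -fimfunE.
have mind (r : R) : measurable_fun setT (fun w : T => r * \1_(h @^-1` [set r]) w * Y w).
  by apply: measurable_funM => //; apply: measurable_funM => //; exact: measurable_indic.
rewrite ge0_integral_fsum//; last 2 first.
- by move=> r; apply/measurable_EFinP; exact: mind.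
- by move=> r w _; rewrite lee_fin mulr_ge0.
apply: eq_fsbigr => r; rewrite inE => -[w0 _ rE].
rewrite [in RHS]integral_mkcond -ge0_integralZl//; last 3 first.
- apply/(measurable_restrictT _ (mh r)).
  by apply: measurable_funTS; exact/measurable_EFinP.
- by move=> w _; apply: erestrict_ge0 => u _; rewrite lee_fin.
- by rewrite lee_fin -rE.
apply: eq_integral => w _; rewrite epatch_indic/= -!EFinM.
by congr EFin; rewrite -mulrA (mulrC (Y w)).
Qed.

(* The bound on the sets of the sub-sigma-algebra says E[Y | G] <= E[B | G];
   multiplying by a G-measurable W >= 0 preserves it. *)
Lemma integral_weight_le {R : realType} {dT} {T : measurableType dT}
    (mu : {measure set T -> \bar R}) (G : set (set T)) (W Y B : T -> R) :
  <<s G >> `<=` @measurable dT T ->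
  @measurable_fun _ _ (g_sigma_algebraType G) R setT W ->
  measurable_fun setT Y -> measurable_fun setT B ->
  (forall w, 0 <= W w) -> (forall w, 0 <= Y w) -> (forall w, 0 <= B w) ->
  (forall A, <<s G >> A -> \int[mu]_(w in A) (Y w)%:E <= \int[mu]_(w in A) (B w)%:E)%E ->
  (\int[mu]_w (W w * Y w)%:E <= \int[mu]_w (W w * B w)%:E)%E.
Proof.
move=> Gm mW mY mB W0 Y0 B0 YB.
have mWe : @measurable_fun _ _ (g_sigma_algebraType G) _ setT (EFin \o W).
  exact/measurable_EFinP.
pose h := nnsfun_approx measurableT mWe.
have W0e w : setT w -> (0 <= (EFin \o W) w)%E by move=> _; rewrite lee_fin.
have hW w : (EFin \o (fun n => h n w)) @ \oo --> (W w)%:E.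
  exact: (cvg_nnsfun_approx measurableT mWe W0e).
have hnd w : {homo (fun n => h n w) : n m / (n <= m)%N >-> n <= m}.
  by move=> n m nm; have /lefP := nd_nnsfun_approx measurableT mWe nm; apply.
have hleW n w : h n w <= W w.
  rewrite -lee_fin -(cvg_lim (@ereal_hausdorff R) (hW w)).
  apply: lime_ge; first by apply/cvg_ex; exists (W w)%:E; exact: hW.
  by exists n => // m /= nm; rewrite lee_fin hnd.
have h0 n w : 0 <= h n w by exact: fun_ge0.
have mh n : measurable_fun setT (h n : T -> R).
  by apply: (measurable_fun_sub G) => //; exact: (measurable_funP (h n)).
have mW' : measurable_fun setT W by exact: (measurable_fun_sub G).
have lim_hY : (\int[mu]_w (h n w * Y w)%:E @[n --> \oo] --> \int[mu]_w (W w * Y w)%:E)%E.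
  have mhY n : measurable_fun setT (fun w : T => (h n w * Y w)%:E).
    by apply/measurable_EFinP; exact: measurable_funM.
  have := @cvg_monotone_convergence _ T R mu setT measurableT
    (fun n (w : T) => (h n w * Y w)%:E) mhY.
  have hY0 n (w : T) : setT w -> (0 <= (h n w * Y w)%:E)%E by move=> _; rewrite lee_fin mulr_ge0.
  have hYnd (w : T) : setT w ->
      {homo (fun n => (h n w * Y w)%:E) : n m / (n <= m)%N >-> (n <= m)%E}.
    by move=> _ n m nm; rewrite lee_fin ler_wpM2r// hnd.
  move=> /(_ hY0 hYnd).
  rewrite (_ : \int[mu]_w (W w * Y w)%:E = \int[mu]_(w in setT)
    ((fun w => limn ((fun n => (h n w * Y w)%:E))) w))%E//.
  apply: eq_integral => w _; apply/esym/cvg_lim => //.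
  by under eq_fun do rewrite EFinM; rewrite EFinM; apply: cvgeZr => //; exact: hW.
rewrite -(cvg_lim (@ereal_hausdorff R) lim_hY).
apply: lime_le; first by apply/cvg_ex; eexists; exact: lim_hY.
(* Only the side of [Y] needs the limit; on the side of [B], [h n <= W] suffices. *)
apply: nearW => n; apply: (@le_trans _ _ (\int[mu]_w (h n w * B w)%:E)%E).
  rewrite !(integral_nnsfun_mul _ G)//; apply: lee_fsum => // r [w _ <-].
  apply: lee_wpmul2l; first by rewrite lee_fin.
  by apply: YB; exact: (measurable_funPTI (h n) (measurable_set1 _)).
apply: ge0_le_integral => //.
- by move=> w _; rewrite lee_fin mulr_ge0.
- by apply/measurable_EFinP; exact: measurable_funM.
- by apply/measurable_EFinP; exact: measurable_funM.
- by move=> w _; rewrite lee_fin ler_wpM2r.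
Qed.

(* A version E may be negative on a null set, whence the detour through its
   positive part. *)
Lemma cond_expectation_le {R : realType} {dT} {T : measurableType dT}
    (P : probability T R) (G : set (set T)) (Y E : T -> \bar R) (B : T -> R) :
  G `<=` @measurable dT T -> is_cond_expectation P G Y E ->
  measurable_fun setT B -> (forall w, 0 <= B w) ->
  {ae P, forall w, (E w <= (B w)%:E)%E} ->
  forall A, G A -> (\int[P]_(w in A) Y w <= \int[P]_(w in A) (B w)%:E)%E.
Proof.
move=> Gm [mE EY] mB B0 EB A GA; have mA := Gm _ GA.
have mE' : measurable_fun setT E by move=> _ C mC; rewrite setTI; apply: Gm; exact: mE.
rewrite -EY// integralE.
apply: (@le_trans _ _ (\int[P]_(w in A) E^\+ w)%E).
  by apply: geeDl; rewrite oppe_le0; apply: integral_ge0 => w _; exact: funeneg_ge0.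
apply: ae_ge0_le_integral => //.
- by apply: measurable_funTS; exact: measurable_funepos.
- by move=> w _; rewrite lee_fin.
- by apply: measurable_funTS; exact/measurable_EFinP.
- move: EB; apply: filterS => w EB _; rewrite funeposE.
  by rewrite comparable_ge_max ?real_comparable// EB lee_fin B0.
Qed.

Definition filtration_generator {dO dT} {Omega : measurableType dO}
    {T : measurableType dT} (z : nat -> {mfun Omega >-> T}) (t : nat) :=
  \bigcup_(k in [set k | (k < t)%N]) preimage_set_system setT (z k) measurable.

Lemma filtration_measurable {dO dT} {Omega : measurableType dO}
    {T : measurableType dT} (z : nat -> {mfun Omega >-> T}) (t : nat) :
  filtration z t `<=` @measurable dO Omega.
Proof.
apply: smallest_sub; first exact: sigma_algebra_measurable.
by move=> _ [k _ [A mA <-]]; exact: (@measurable_funPT _ _ _ _ (z k)).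
Qed.

(** Changing the sigma-algebra of the domain, rather than using [measurable_wrt], makes the closure
    properties of measurable functions available for adapted processes. *)
Definition measurable_past {dO dT dU} {Omega : measurableType dO}
    {T : measurableType dT} {U : measurableType dU}
    (z : nat -> {mfun Omega >-> T}) (t : nat) (X : Omega -> U) :=
  @measurable_fun _ _ (g_sigma_algebraType (filtration_generator z t)) U setT X.

Lemma measurable_past_noise {dO dT} {Omega : measurableType dO}
    {T : measurableType dT} (z : nat -> {mfun Omega >-> T}) (t k : nat) :
  (k < t)%N -> measurable_past z t (z k).
Proof. by move=> kt _ A mA; apply: sub_sigma_algebra; exists k => //; exists A. Qed.

(** The exponential at [t.+1] factors as [W * Y] with [W] known from the past. The moment bound
    replaces [Y] by [B], and [W * B] is the exponential at [t], so the expectation never exceeds its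
    initial value 1. *)
Lemma mgf_supermartingale {R : realType} {dO} {Omega : measurableType dO}
    (P : probability Omega R) {d} (z : nat -> {mfun Omega >-> 'rV[R]_d})
    (e X : nat -> Omega -> 'rV[R]_d) (N : R) :
  (forall k t, (k < t)%N -> measurable_past z t (e k)) ->
  (forall k t, (k <= t)%N -> measurable_past z t (X k)) ->
  effective_noise_mgf P z e N -> forall t,
  (\int[P]_w (expR (\sum_(k < t) (dotv (X k w) (e k w) - N * enorm (X k w) ^+ 2)))%:E
   <= 1)%E.
Proof.
move=> me mX mgf; elim=> [|t IH].
  under eq_integral do rewrite big_ord0 expR0.
  by rewrite integral_cst// mul1e probability_le1.
pose S t w := \sum_(k < t) (dotv (X k w) (e k w) - N * enorm (X k w) ^+ 2).
pose G := filtration_generator z t.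
have Gm : <<s G >> `<=` @measurable dO Omega := filtration_measurable z t.
have mS : measurable_past z t (S t).
  apply: measurable_sum => k; apply: measurable_funB.
    by apply: measurable_dotv; [exact: mX (ltnW _) | exact: me].
  by apply: measurable_funM => //; apply/measurable_funX/measurable_enorm; exact: mX (ltnW _).
have mXt := mX t t (leqnn t).
have mX' : measurable_fun setT (X t) := measurable_fun_sub G (X t) Gm mXt.
have me' : measurable_fun setT (e t).
  apply: (measurable_fun_sub (filtration_generator z t.+1)); last exact: me.
  exact: (filtration_measurable z t.+1).
have mN2 : measurable_fun setT (fun w => N * enorm (X t w) ^+ 2).
  by apply: measurable_funM => //; apply/measurable_funX/measurable_enorm.
(* The compensator of step [t] is put into [W]: it depends on [X t] alone, hence on the past, and
   cancels against [B]. *)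
pose W w := expR (S t w - N * enorm (X t w) ^+ 2).
pose Y w := expR (dotv (X t w) (e t w)).
pose B w := expR (N * enorm (X t w) ^+ 2).
have mB : measurable_fun setT B by exact: measurableT_comp.
have mY : measurable_fun setT Y by apply: measurableT_comp => //; exact: measurable_dotv.
have mW : measurable_past z t W.
  apply: (measurableT_comp (@measurable_expR R)); apply: measurable_funB => //.
  by apply: measurable_funM => //; apply/measurable_funX/measurable_enorm.
have YB A : <<s G >> A -> (\int[P]_(w in A) (Y w)%:E <= \int[P]_(w in A) (B w)%:E)%E.
  have mXw : measurable_wrt (filtration z t) (X t).
    by move=> C mC; have := mXt measurableT C mC; rewrite setTI.
  have [E cE EB] := mgf t (X t) mXw.
  by apply: (cond_expectation_le P _ (EFin \o Y) E) => // w; exact: expR_ge0.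
apply: le_trans IH.
have -> : (\int[P]_w (expR (\sum_(k < t.+1)
    (dotv (X k w) (e k w) - N * enorm (X k w) ^+ 2)))%:E = \int[P]_w (W w * Y w)%:E)%E.
  apply: eq_integral => w _; congr EFin; rewrite -expRD big_ord_recr/=; congr expR.
  by rewrite /S; ring.
apply: le_trans (integral_weight_le P G W Y B Gm mW mY mB _ _ _ YB) _.
- by move=> w; exact: expR_ge0.
- by move=> w; exact: expR_ge0.
- by move=> w; exact: expR_ge0.
rewrite le_eqVlt; apply/orP; left; apply/eqP; apply: eq_integral => w _.
by rewrite -expRD subrK.
Qed.

(** Markov's inequality for [expR (S w)] at level [1 / beta], followed by passage to the
    complement. *)
Lemma exp_tail_bound {R : realType} {dO} {Omega : measurableType dO}
    (P : probability Omega R) (S : Omega -> R) (beta : R) :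
  measurable_fun setT S -> 0 < beta ->
  (\int[P]_w (expR (S w))%:E <= 1)%E ->
  ((1 - beta)%:E <= P [set w | (S w <= ln (1 / beta))%R])%E.
Proof.
move=> mS b0 H.
have mA : measurable [set w | S w <= ln (1 / beta)].
  by rewrite -[X in measurable X]setTI; apply: measurable_fun_le => //; exact: measurable_cst.
have mC := measurableC mA.
suff PC : (P (~` [set w | (S w <= ln (1 / beta))%R]) <= beta%:E)%E.
  rewrite -[X in P X]setCK probability_setC// EFinB.
  by apply: leeB.
have ib : 0 <= 1 / beta by rewrite divr_ge0// ltW.
have : ((1 / beta)%:E * P (~` [set w | (S w <= ln (1 / beta))%R]) <= 1)%E.
  apply: le_trans H; rewrite -[X in (_ * P X)%E]setIT -integral_indic//.
  rewrite -ge0_integralZl//; last first.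
    by apply/measurable_EFinP; exact: measurable_indic.
  apply: ge0_le_integral => //.
  - by move=> w _; rewrite -EFinM lee_fin mulr_ge0.
  - apply/measurable_EFinP; apply: measurable_funM => //; exact: measurable_indic.
  - by apply/measurable_EFinP; exact: measurableT_comp.
  move=> w _; rewrite -EFinM lee_fin indicE.
  case: (boolP (w \in _)) => [|_]; last by rewrite mulr0 expR_ge0.
  rewrite inE /= => /negP; rewrite -ltNge => Sw.
  by rewrite mulr1 -[leLHS]lnK ?posrE ?divr_gt0// ler_expR ltW.
have Pf := fin_num_measure P _ mC.
by rewrite -(fineK Pf) -EFinM !lee_fin mul1r mulrC ler_pdivrMr// mul1r.
Qed.

(** * High-probability bound for the averaged iterates *)

Lemma phi_prime_gt0 {R : realType} {d} (hd : (0 < d)%N) (N1 : R -> R)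
    (p : 'rV[R]_d -> R) :
  (forall i, 0 < derive1 (phi N1 p i) 0) -> 0 < phi_prime hd N1 p.
Proof.
by move=> H; rewrite /phi_prime; elim/big_rec: _ => // i x _ x0; rewrite lt_min H.
Qed.

Lemma integrable_density {R : realType} {dO} {Omega : measurableType dO}
    (P : probability Omega R) {d} (p : 'rV[R]_d -> R)
    (z : nat -> {mfun Omega >-> 'rV[R]_d}) :
  noise_assumption P p z -> (lebesgue_rV R d).-integrable setT (EFin \o p).
Proof.
case=> _ _ _ _ mp p0 dens _ _; apply/integrableP; split; first exact/measurable_EFinP.
under eq_integral do rewrite /= ger0_norm//.
by rewrite -(dens 0%N _ measurableT) /distribution /pushforward probability_setT ltry.
Qed.

Theorem theorem2 (R : realType) (d : nat) (hd : (0 < d)%N)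
  (f : 'rV[R]_d -> R) (L mu : R) (xs : 'rV[R]_d)
  (f_diff : forall x, differentiable f x)
  (L_gt0 : 0 < L) (f_smooth : lipschitz_gradient L f)
  (mu_gt0 : 0 < mu) (f_sc : strongly_convex mu f)
  (f_min : unique_minimizer f xs)
  (N1 : R -> R) (C1 : R) (N1_adm : admissible C1 N1)
  (dO : measure_display) (Omega : measurableType dO) (P : probability Omega R)
  (p : 'rV[R]_d -> R) (z : nat -> {mfun Omega >-> 'rV[R]_d})
  (z_noise : noise_assumption P p z)
  (phi_diff : forall i : 'I_d, derivable (phi N1 p i) 0 1)
  (phi_gt0 : forall i : 'I_d, 0 < derive1 (phi N1 p i) 0)
  (xi : R) (xi_gt0 : 0 < xi)
  (xiP : forall x : 'rV[R]_d,
    phi_prime hd N1 p / 2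
      * Num.min (xi * enorm x / Num.sqrt d%:R) (enorm x ^+ 2 / d%:R)
    <= dotv (Phi N1 p x) x)
  (x0 : 'rV[R]_d) (a delta : R)
  (a_gt0 : 0 < a) (delta_gt : 3 / 4 < delta) (delta_lt : delta < 1)
  (N : R) (N_gt0 : 0 < N)
  (NP : effective_noise_mgf P z
    (fun t w => effective_noise f N1 p
       (sgd f N1 (step_size a delta) x0 z t w) (z t w)) N)
  (t : nat) (t_ge1 : (1 <= t)%N)
  (beta : R) (beta_gt0 : 0 < beta) (beta_lt1 : beta < 1) :
  ((1 - beta)%:E <= P [set w |
     huber (xi * Num.sqrt d%:R / mu)
       (enorm (weighted_average (step_size a delta)
          (fun k => sgd f N1 (step_size a delta) x0 z k w) t - xs))
     <= R_tilde d mu L C1 N (phi_prime hd N1 p)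
          (f x0 - inf (range f)) (dist_stationary f x0) a beta delta
        / (t.+2%:R `^ (1 - delta) - 2 `^ (1 - delta))]%R)%E.
Proof.
have [fmin _] := f_min.
rewrite (dist_stationaryE f L mu xs x0)// (inf_range_minimizer _ f xs fmin).
have [_ _ N1nd _ _ _ NC] := N1_adm.
have mg := measurable_gradient f L L_gt0 f_smooth.
have mPsi := @measurable_Psi R d N1 N1nd.
have mPhi : measurable_fun setT (Phi N1 p).
  apply: (measurable_Phi N1 C1) => //; first by case: z_noise.
  exact: (integrable_density P p z).
pose x k w := sgd f N1 (step_size a delta) x0 z k w.
pose e k w := effective_noise f N1 p (x k w) (z k w).
(* With the step size included, the moment bound at [X k] yields exactly the compensated noise terms
   of [sgd_deterministic]. *)
pose X k w := step_size a delta k *: gradient f (x k w).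
have mx k s : (k <= s)%N -> measurable_past z s (x k).
  move=> ks; apply: measurable_sgd => // j jk.
  by apply: measurable_past_noise; exact: leq_trans jk ks.
have mX k s : (k <= s)%N -> measurable_past z s (X k).
  by move=> ks; apply/measurable_rVZ/(measurableT_comp mg); exact: mx.
(* The inequality is strict because [e k] involves [z k], which belongs to the past only from time
   [k.+1] on. *)
have me k s : (k < s)%N -> measurable_past z s (e k).
  move=> ks; have mgx := measurableT_comp mg (mx k s (ltnW ks)).
  apply: measurable_rVB; apply: measurableT_comp => //.
  by apply: measurable_rVD => //; exact: measurable_past_noise.
pose S w := \sum_(k < t) (dotv (X k w) (e k w) - N * enorm (X k w) ^+ 2).
have toO (U : measurableType rV_display) (Y : Omega -> U) s :
    measurable_past z s Y -> measurable_fun setT Y.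
  by apply: measurable_fun_sub; exact: filtration_measurable.
have mS : measurable_fun setT S.
  apply: measurable_sum => k.
  have mXk : measurable_fun setT (X k) := toO _ _ k (mX k k (leqnn k)).
  have mek : measurable_fun setT (e k) := toO _ _ k.+1 (me k k.+1 (leqnn _)).
  apply: measurable_funB; first exact: measurable_dotv.
  by apply: measurable_funM => //; apply/measurable_funX/measurable_enorm.
have := exp_tail_bound P S beta mS beta_gt0 (mgf_supermartingale P z e X N me mX NP t).
(* It remains to include the event [S w <= ln (1 / beta)] in the stated one, both being measurable;
   the inclusion is proved trajectory by trajectory. *)
move=> /le_trans; apply; apply: le_measure; rewrite ?inE.
- by rewrite -[X in measurable X]setTI; apply: measurable_fun_le.
- rewrite -[X in measurable X]setTI; apply: measurable_fun_le => //.
  apply: (measurableT_comp (measurable_huber _)); apply: measurable_enorm.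
  apply: measurable_rVB => //; apply: measurable_fun_rV => i.
  under eq_fun do rewrite summxE; apply: measurable_sum => k.
  apply: measurable_rV_entry; apply: measurable_rVZ.
  exact: toO _ _ k (mx k k (leqnn k)).
move=> w /= Sw.
apply: (sgd_deterministic hd f L mu C1 N _ xi a delta beta N1 (Phi N1 p)
  (fun k => x k w) (fun k => gradient f (x k w) + z k w)) => //.
- exact: phi_prime_gt0.
- by rewrite delta_gt.
- exact: ltW.
- apply: le_trans Sw; rewrite le_eqVlt; apply/orP; left; apply/eqP.
  apply: eq_bigr => k _.
  by rewrite /X enormZ dotvZl [in RHS]exprMn real_normK ?num_real.
Qed.
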